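(* (a) The peak number $\mathrm{pk}$ is shuffle-compatible. (b) The linear map on $\mathcal{A}_{\mathrm{pk}}$ defined by $[\pi]_{\mathrm{pk}}\mapsto\frac{2^{2\mathrm{pk}(\pi)+1}t^{\mathrm{pk}(\pi)+1}(1+t)^{|\pi|-2\mathrm{pk}(\pi)-1}}{(1-t)^{|\pi|+1}}x^{|\pi|}$ if $|\pi|\ge1$ and $[\pi]_{\mathrm{pk}}\mapsto1/(1-t)$ if $|\pi|=0$ is a $\mathbb{Q}$-algebra isomorphism from $\mathcal{A}_{\mathrm{pk}}$ to the span of $\{\frac1{1-t}\}\cup\{\frac{2^{2j+1}t^{j+1}(1+t)^{n-2j-1}}{(1-t)^{n+1}}x^n\}_{n\ge1,\,0\le j\le\lfloor(n-1)/2\rfloor}$, a subalgebra of $\mathbb{Q}[[t*]][x]$. (c) $\mathcal{A}_{\mathrm{pk}}$ is isomorphic to the span of $\{1\}\cup\{p^jx^n\}_{n\ge1,\,1\le j\le n,\,j\equiv n\ (\mathrm{mod}\ 2)}$, a subalgebra of $\mathbb{Q}[p,x]$. (d) For $n\ge1$, the $n$th homogeneous component of $\mathcal{A}_{\mathrm{pk}}$ has dimension $\lfloor(n+1)/2\rfloor$.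
   Context: A permutation of length $n$ is a sequence $\pi=\pi_1\cdots\pi_n$ of distinct positive integers. A peak is an index $2\le i\le n-1$ with $\pi_{i-1}<\pi_i>\pi_{i+1}$; $\mathrm{pk}(\pi)$ is the number of peaks. For disjoint permutations, $S(\pi,\sigma)$ is the set of shuffles (permutations of length $|\pi|+|\sigma|$ containing both as subsequences). A statistic $\mathrm{st}$ is shuffle-compatible if for disjoint $\pi,\sigma$ the multiset $\{\mathrm{st}(\tau):\tau\in S(\pi,\sigma)\}$ depends only on $\mathrm{st}(\pi),\mathrm{st}(\sigma),|\pi|,|\sigma|$; its shuffle algebra $\mathcal{A}_{\mathrm{st}}$ has basis the classes $[\pi]_{\mathrm{st}}$ of permutations with equal length and $\mathrm{st}$-value, product $[\pi]_{\mathrm{st}}[\sigma]_{\mathrm{st}}=\sum_{\tau\in S(\pi,\sigma)}[\tau]_{\mathrm{st}}$, graded by length. $\mathbb{Q}[[t*]][x]$ denotes polynomials in $x$ with coefficients formal power series in $t$, with multiplication ordinary in $x$ and the Hadamard product $(\sum a_nt^n)*(\sum b_nt^n)=\sum a_nb_nt^n$ in $t$. *)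

(* Defs.v *)
From HB Require Import structures.
From mathcomp Require Import all_boot all_order all_algebra generic_quotient.
From mathcomp Require Import finmap boolp classical_sets functions.
From mathcomp.multinomials Require mpoly.
From mathcomp.multinomials Require Import monalg.
From mathcomp Require Import zify.

Set Implicit Arguments.
Unset Strict Implicit.
Unset Printing Implicit Defensive.

Import GRing.Theory.

Local Open Scope ring_scope.
Local Open Scope quotient_scope.

(* A permutation is a finite sequence of distinct positive integers; its
   letters need not be 1, ..., n. *)
Record wperm := WPerm {
  word :> seq nat;
  wordP : uniq word && all (leq 1) word
}.

HB.instance Definition _ := [isSub for word].
HB.instance Definition _ := [Countable of wperm by <:].

Lemma wperm_uniq (p : wperm) : uniq p.
Proof. by case/andP: (wordP p). Qed.

Lemma wperm_pos (p : wperm) : all (leq 1) p.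
Proof. by case/andP: (wordP p). Qed.

Definition wperm0 : wperm := @WPerm [::] isT.

Definition disjoint_perm (p q : wperm) : bool := ~~ has (mem (word p)) q.

(* If p and q are disjoint then insub never fails here; see [mem_shuffles] and
   [shuffles_uniq] below. *)
Definition shuffles (p q : wperm) : seq wperm :=
  pmap insub [seq w <- permutations (p ++ q) | subseq p w && subseq q w].

Definition same_order (p q : wperm) : Prop :=
  size p = size q /\
  forall i j, (i < size p)%N -> (j < size p)%N ->
    (nth 0 p i < nth 0 p j)%N = (nth 0 q i < nth 0 q j)%N.

Record statistic (T : eqType) := Statistic {
  stat :> wperm -> T;
  statP : forall p q, same_order p q -> stat p = stat q
}.

Definition shuffle_compatible (T : eqType) (st : statistic T) : Prop :=
  forall p q p' q' : wperm,
    disjoint_perm p q -> disjoint_perm p' q' ->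
    st p = st p' -> st q = st q' -> size p = size p' -> size q = size q' ->
    perm_eq (map st (shuffles p q)) (map st (shuffles p' q')).

Section Shuffles.
Implicit Types p q r u v w : wperm.

Lemma disjoint_permP p q :
  reflect (forall x, x \in (p : seq nat) -> x \notin (q : seq nat))
          (disjoint_perm p q).
Proof.
apply: (iffP hasPn) => H x.
  by move=> xp; apply/negP => /H; rewrite /= xp.
by move=> xq; apply/negP => /H; rewrite xq.
Qed.

Lemma disjointC p q : disjoint_perm p q = disjoint_perm q p.
Proof. by rewrite /disjoint_perm has_sym. Qed.

Lemma disjoint_uniq p q : disjoint_perm p q -> uniq (p ++ q).
Proof. by move=> d; rewrite cat_uniq !wperm_uniq andbT. Qed.

Lemma shuffles_uniq p q : uniq (shuffles p q).
Proof.
by apply: (pmap_uniq (g := word)) (filter_uniq _ (permutations_uniq _)); exact: insubK.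
Qed.

Lemma mem_shuffles p q u : disjoint_perm p q ->
  (u \in shuffles p q) =
  [&& size u == (size p + size q)%N, subseq p u & subseq q u].
Proof.
move=> d; rewrite /shuffles mem_pmap_sub mem_filter mem_permutations /=.
rewrite andbC; apply/and3P/and3P => [[a b c]|[/eqP a b c]]; split=> //.
  by rewrite (perm_size a) size_cat.
rewrite perm_sym; apply: uniq_perm; rewrite ?disjoint_uniq ?wperm_uniq //.
have [||_ E //] := uniq_min_size (s2 := word u) (disjoint_uniq d).
- by move=> x; rewrite mem_cat => /orP[]; apply: mem_subseq.
- by rewrite size_cat a.
Qed.

Lemma mem_word_shuffles p q u : disjoint_perm p q -> u \in shuffles p q ->
  (u : seq nat) =i (p : seq nat) ++ q.
Proof.
move=> d; rewrite mem_pmap_sub mem_filter mem_permutations => /andP[_].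
exact: perm_mem.
Qed.

Definition filter_perm (a : pred nat) u : wperm.
Proof.
exists (filter a u); rewrite filter_uniq ?wperm_uniq //=.
by apply/allP => x; rewrite mem_filter => /andP[_]; apply: (allP (wperm_pos u)).
Defined.

Lemma subseq_filter_perm (a : pred nat) u w :
  {subset word w <= a} -> subseq w u -> subseq w (filter a u).
Proof. by move=> H s; rewrite subseq_filter s andbT; apply/allP. Qed.

(* Triple shuffles: both bracketings enumerate the permutations of length
   |p| + |q| + |r| containing p, q and r. *)
Lemma big_shuffles3 (V : nmodType) (F : wperm -> V) p q r :
  disjoint_perm p q -> disjoint_perm p r -> disjoint_perm q r ->
  \sum_(u <- shuffles p q) \sum_(v <- shuffles u r) F v =
  \sum_(u <- shuffles q r) \sum_(v <- shuffles p u) F v.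
Proof.
move=> pq pr qr.
have dl u : u \in shuffles p q -> disjoint_perm u r.
  move/(mem_word_shuffles pq) => E; apply/disjoint_permP => x; rewrite E mem_cat.
  by case/orP; apply/disjoint_permP.
have dr u : u \in shuffles q r -> disjoint_perm p u.
  move/(mem_word_shuffles qr) => E; apply/disjoint_permP => x xp.
  by rewrite E mem_cat negb_or (disjoint_permP _ _ pq) // (disjoint_permP _ _ pr).
rewrite -(big_allpairs_dep (h := fun _ v => v)).
rewrite -[RHS](big_allpairs_dep (h := fun _ v => v)).
apply: perm_big; apply: uniq_perm.
- apply: allpairs_uniq_dep; [exact: shuffles_uniq | move=> x _; exact: shuffles_uniq |].
  move=> _ _ /allpairsPdep[u [v [us vs ->]]] /allpairsPdep[u' [v' [us' vs' ->]]] /= vv.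
  move: vs'; rewrite -{v'}vv => vs'.
  suff -> : u = u' by [].
  move: vs vs'; rewrite !mem_shuffles ?dl // => /and3P[_ s _] /and3P[_ s' _].
  apply: val_inj => /=.
  rewrite (subseq_uniqP (wperm_uniq v) s) (subseq_uniqP (wperm_uniq v) s').
  by apply: eq_filter => x /=; rewrite (mem_word_shuffles pq us) (mem_word_shuffles pq us').
- apply: allpairs_uniq_dep; [exact: shuffles_uniq | move=> x _; exact: shuffles_uniq |].
  move=> _ _ /allpairsPdep[u [v [us vs ->]]] /allpairsPdep[u' [v' [us' vs' ->]]] /= vv.
  move: vs'; rewrite -{v'}vv => vs'.
  suff -> : u = u' by [].
  move: vs vs'; rewrite !mem_shuffles ?dr // => /and3P[_ _ s] /and3P[_ _ s'].
  apply: val_inj => /=.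
  rewrite (subseq_uniqP (wperm_uniq v) s) (subseq_uniqP (wperm_uniq v) s').
  by apply: eq_filter => x /=; rewrite (mem_word_shuffles qr us) (mem_word_shuffles qr us').
have fsize (a b v : wperm) : disjoint_perm a b -> subseq a v -> subseq b v ->
    size (filter_perm (mem ((a : seq nat) ++ b)) v) = (size a + size b)%N.
  move=> d sa sb; rewrite -size_cat /=; apply/perm_size/uniq_perm.
  - by rewrite filter_uniq ?wperm_uniq.
  - exact: disjoint_uniq.
  move=> x; rewrite mem_filter /= mem_cat.
  apply/andP/idP => [[]//|H]; split=> //.
  by case/orP: H; apply: mem_subseq.
move=> v; transitivity [&& size v == (size p + size q + size r)%N,
    subseq p v, subseq q v & subseq r v].
  apply/allpairsPdep/and4P => [[u [w [us ws ->]]]|[/eqP sv sp sq sr]].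
    move: ws; rewrite mem_shuffles ?dl // => /and3P[/eqP -> s1 ->].
    move: us; rewrite mem_shuffles // => /and3P[/eqP -> s2 s3].
    by rewrite eqxx !(subseq_trans _ s1).
  have us : filter_perm (mem ((p : seq nat) ++ q)) v \in shuffles p q.
    rewrite mem_shuffles // fsize // eqxx /= !subseq_filter_perm // => x xp;
      by rewrite /= inE mem_cat xp ?orbT.
  exists (filter_perm (mem ((p : seq nat) ++ q)) v), v; split=> //.
  by rewrite mem_shuffles ?dl // fsize // sv eqxx sr andbT; exact: filter_subseq.
apply/esym; apply/allpairsPdep/and4P => [[u [w [us ws ->]]]|[/eqP sv sp sq sr]].
  move: ws; rewrite mem_shuffles ?dr // => /and3P[/eqP -> -> s1].
  move: us; rewrite mem_shuffles // => /and3P[/eqP -> s2 s3].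
  by rewrite addnA eqxx !(subseq_trans _ s1).
have us : filter_perm (mem ((q : seq nat) ++ r)) v \in shuffles q r.
  rewrite mem_shuffles // fsize // eqxx /= !subseq_filter_perm // => x xp;
    by rewrite /= inE mem_cat xp ?orbT.
exists (filter_perm (mem ((q : seq nat) ++ r)) v), v; split=> //.
by rewrite mem_shuffles ?dr // fsize // sv addnA eqxx sp /=; exact: filter_subseq.
Qed.

Lemma disjoint0p p : disjoint_perm wperm0 p.
Proof. by apply/disjoint_permP. Qed.

Lemma disjointp0 p : disjoint_perm p wperm0.
Proof. by rewrite disjointC disjoint0p. Qed.

Lemma shuffles_single p q u : disjoint_perm p q ->
  (forall v, (v \in shuffles p q) = (v == u)) -> shuffles p q = [:: u].
Proof.
move=> d H; apply/perm_small_eq => //; apply: uniq_perm; rewrite ?shuffles_uniq //.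
by move=> v; rewrite H inE.
Qed.

Lemma eq_subseq_size u v : (size u == size v) && subseq v u = (u == v).
Proof.
apply/andP/eqP => [[/eqP s t]|->]; last by rewrite eqxx subseq_refl.
by apply: val_inj; apply/esym/eqP; rewrite -(size_subseq_leqif t) s.
Qed.

Lemma shuffles0p p : shuffles wperm0 p = [:: p].
Proof.
apply: shuffles_single (disjoint0p p) _ => v; rewrite mem_shuffles ?disjoint0p //=.
by rewrite sub0seq add0n /= eq_subseq_size.
Qed.

Lemma shufflesp0 p : shuffles p wperm0 = [:: p].
Proof.
apply: shuffles_single (disjointp0 p) _ => v; rewrite mem_shuffles ?disjointp0 //=.
by rewrite sub0seq addn0 andbT /= eq_subseq_size.
Qed.

Definition shift_perm (m : nat) p : wperm.
Proof.
exists (map (addn m) p); rewrite map_inj_uniq ?wperm_uniq; last exact: addnI.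
by apply/allP => _ /mapP[x /(allP (wperm_pos p)) x0 ->]; rewrite ltn_addl.
Defined.

Lemma shift_same_order m p : same_order p (shift_perm m p).
Proof.
split=> [|i j ip jp] /=; first by rewrite size_map.
by rewrite !(nth_map 0%N) // ltn_add2l.
Qed.

Definition max_letter p : nat := foldr maxn 0%N p.

Lemma leq_max_letter p x : x \in (p : seq nat) -> (x <= max_letter p)%N.
Proof.
rewrite /max_letter; elim: (p : seq nat) => //= y s IH; rewrite inE => /orP[/eqP->|/IH]; lia.
Qed.

(* A copy of q, in the same relative order, that avoids the letters of p. *)
Definition away p q : wperm := shift_perm (max_letter p) q.

Lemma shift_disjoint m p q : (max_letter p <= m)%N ->
  disjoint_perm p (shift_perm m q).
Proof.
move=> pm; apply/disjoint_permP => x /leq_max_letter H.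
by apply/negP => /mapP[y /(allP (wperm_pos q))]; lia.
Qed.

Lemma away_disjoint p q : disjoint_perm p (away p q).
Proof. exact: shift_disjoint. Qed.

End Shuffles.

Section StatClasses.
Variables (T : eqType) (st : statistic T).

Definition st_equiv : rel wperm := fun p q => (size p == size q) && (st p == st q).

Lemma st_equiv_refl : reflexive st_equiv.
Proof. by move=> p; rewrite /st_equiv !eqxx. Qed.
Lemma st_equiv_sym : symmetric st_equiv.
Proof. by move=> p q; rewrite /st_equiv eq_sym [st p == _]eq_sym. Qed.
Lemma st_equiv_trans : transitive st_equiv.
Proof. by move=> q p r /andP[/eqP a /eqP b] /andP[/eqP c /eqP d]; rewrite /st_equiv a b c d !eqxx. Qed.

Canonical st_equiv_rel := EquivRel st_equiv st_equiv_refl st_equiv_sym st_equiv_trans.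

Definition st_class := {eq_quot st_equiv_rel}.
HB.instance Definition _ := Choice.on st_class.
HB.instance Definition _ := EqQuotient.on st_class.

Lemma st_classP (p q : wperm) :
  reflect (size p = size q /\ st p = st q) (\pi_st_class p == \pi_st_class q).
Proof.
rewrite piE; apply: (iffP andP) => [[/eqP ? /eqP ?]|[-> ->]] //; by rewrite !eqxx.
Qed.

End StatClasses.

(* The product does not depend on the proof of compatibility [hst]; the latter
   is an argument because it is needed for the ring axioms. *)
Definition shuffle_alg (T : eqType) (st : statistic T)
  (hst : shuffle_compatible st) := {malg rat[st_class st]}.

Definition class_of (T : eqType) (st : statistic T)
  (hst : shuffle_compatible st) (p : wperm) : shuffle_alg hst :=
  << \pi_(st_class st) p >>.

Lemma malg_ind (K : choiceType) (P : {malg rat[K]} -> Prop) :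
  P 0 -> (forall a k f, P f -> P (a *: << k >> + f)) -> forall f, P f.
Proof.
move=> P0 PD f; rewrite (monalgE f); elim/big_rec: _ => // k g _ Pg.
have -> : << f@_k *g k >> = f@_k *: << k >> :> {malg rat[K]}; last exact: PD.
by apply/malgP => l; rewrite mcoeffZ !mcoeffU; case: eqP; rewrite ?mulr1 ?mulr0.
Qed.

Section LinearExtension.
Variables (K : choiceType) (V : lmodType rat).

Definition lin_ext (h : K -> V) (f : {malg rat[K]}) : V :=
  \sum_(k <- msupp f) f@_k *: h k.

Lemma lin_extEw (d : {fset K}) h f : (msupp f `<=` d)%fset ->
  lin_ext h f = \sum_(k <- d) f@_k *: h k.
Proof.
move=> sfd; rewrite /lin_ext (big_fset_incl _ sfd) // => k _ /mcoeff_outdom ->.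
by rewrite scale0r.
Qed.

Lemma lin_ext_linear h : linear (lin_ext h).
Proof.
move=> a f g; pose d := (msupp f `|` msupp g `|` msupp (a *: f + g))%fset.
have df : (msupp f `<=` d)%fset by rewrite /d -fsetUA fsubsetUl.
have dg : (msupp g `<=` d)%fset by rewrite /d fsetUAC fsubsetUr.
have da : (msupp (a *: f + g) `<=` d)%fset by rewrite /d fsubsetUr.
rewrite (lin_extEw _ df) (lin_extEw _ dg) (lin_extEw _ da).
rewrite scaler_sumr -big_split /=; apply: eq_bigr => k _.
by rewrite mcoeffD mcoeffZ scalerDl scalerA.
Qed.

HB.instance Definition _ h :=
  GRing.isLinear.Build rat {malg rat[K]} V _ (lin_ext h) (lin_ext_linear h).

Lemma lin_extU h k : lin_ext h << k >> = h k.
Proof. by rewrite /lin_ext msuppU oner_eq0 big_seq_fset1 mcoeffUU scale1r. Qed.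

End LinearExtension.

Section BilinearAssoc.
Variables (A : lmodType rat) (I : Type) (e : I -> A) (m : A -> A -> A).
Hypothesis Aind : forall P : A -> Prop,
  P 0 -> (forall a i f, P f -> P (a *: e i + f)) -> forall f, P f.
Hypothesis ml : forall g, linear (m^~ g).
Hypothesis mr : forall f, linear (m f).

Lemma bilin0l g : m 0 g = 0.
Proof. by have := ml g (-1) 0 0; rewrite scaler0 addr0 scaleN1r addNr. Qed.

Lemma bilin0r f : m f 0 = 0.
Proof. by have := mr f (-1) 0 0; rewrite scaler0 addr0 scaleN1r addNr. Qed.

Lemma bilinZl a f g : m (a *: f) g = a *: m f g.
Proof. by have := ml g a f 0; rewrite /= !addr0 bilin0l addr0. Qed.

Lemma bilinZr a f g : m f (a *: g) = a *: m f g.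
Proof. by have := mr f a g 0; rewrite /= !addr0 bilin0r addr0. Qed.

Lemma bilinDl : left_distributive m +%R.
Proof. by move=> f f' g; have := ml g 1 f f'; rewrite !scale1r. Qed.

Lemma bilinDr : right_distributive m +%R.
Proof. by move=> f g g'; have := mr f 1 g g'; rewrite !scale1r. Qed.

Lemma bilin_suml (J : Type) (s : seq J) (F : J -> A) g :
  m (\sum_(i <- s) F i) g = \sum_(i <- s) m (F i) g.
Proof.
by apply: (big_morph (m^~ g)) => [x y|]; [exact: bilinDl | exact: bilin0l].
Qed.

Lemma bilin_sumr (J : Type) (s : seq J) (F : J -> A) f :
  m f (\sum_(i <- s) F i) = \sum_(i <- s) m f (F i).
Proof.
by apply: (big_morph (m f)) => [x y|]; [exact: bilinDr | exact: bilin0r].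
Qed.

Lemma bilin_assoc :
  (forall i j k, m (e i) (m (e j) (e k)) = m (m (e i) (e j)) (e k)) ->
  associative m.
Proof.
move=> H; elim/Aind => [g h|a p f IH g h]; first by rewrite !bilin0l.
rewrite !bilinDl !bilinZl IH; congr (_ *: _ + _).
elim/Aind: g => [|b q g IHg]; first by rewrite !(bilin0l, bilin0r).
rewrite !(bilinDl, bilinDr) !(bilinZl, bilinZr) IHg; congr (_ *: _ + _).
elim/Aind: h {IHg} => [|c r h IHh]; first by rewrite !bilin0r.
by rewrite !bilinDr !bilinZr IHh H.
Qed.

Lemma bilin_left_id i0 : (forall i, m (e i0) (e i) = e i) -> left_id (e i0) m.
Proof.
move=> H; elim/Aind => [|a i f IH]; first by rewrite bilin0r.
by rewrite bilinDr bilinZr IH H.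
Qed.

Lemma bilin_right_id i0 : (forall i, m (e i) (e i0) = e i) -> right_id (e i0) m.
Proof.
move=> H; elim/Aind => [|a i f IH]; first by rewrite bilin0l.
by rewrite bilinDl bilinZl IH H.
Qed.

End BilinearAssoc.

Section ShuffleAlgebra.
Variables (T : eqType) (st : statistic T) (hst : shuffle_compatible st).
Local Notation A := (shuffle_alg hst).
Local Notation K := (st_class st).
Local Notation cls := (class_of hst).
Implicit Types p q r u : wperm.

HB.instance Definition _ := Choice.copy A {malg rat[K]}.
HB.instance Definition _ := GRing.Lmodule.copy A {malg rat[K]}.

Definition shuffle_mul_class (k l : K) : A :=
  \sum_(u <- shuffles (repr k) (away (repr k) (repr l))) cls u.

Definition shuffle_mul (f g : A) : A :=
  lin_ext (fun k => lin_ext (fun l => shuffle_mul_class k l) g : A) f.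


Lemma class_ofP p q : reflect (size p = size q /\ st p = st q) (cls p == cls q).
Proof.
apply: (iffP eqP) => [|/st_classP/eqP]; last by rewrite /class_of => ->.
move/malgP/(_ (\pi q)); rewrite mcoeffUU mcoeffU.
by case: (st_classP st p q) => // _ /eqP; rewrite eq_sym oner_eq0.
Qed.

Lemma repr_class (p : wperm) :
  size (repr (\pi_K p)) = size p /\ st (repr (\pi_K p)) = st p.
Proof. by apply/st_classP; rewrite reprK. Qed.

Lemma shuffles_size p q u : disjoint_perm p q -> u \in shuffles p q ->
  size u = (size p + size q)%N.
Proof. by move=> d; rewrite mem_shuffles // => /and3P[/eqP]. Qed.

Lemma sum_shuffles_class p q p' q' :
    disjoint_perm p q -> disjoint_perm p' q' ->
    st p = st p' -> st q = st q' -> size p = size p' -> size q = size q' ->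
  \sum_(u <- shuffles p q) cls u = \sum_(u <- shuffles p' q') cls u.
Proof.
move=> d d' ep eq sp sq; have PE := hst d d' ep eq sp sq.
pose s := shuffles p q.
pose g t := cls (nth wperm0 s (index t (map st s))).
have gE u : size u = (size p + size q)%N -> st u \in map st s -> cls u = g (st u).
  move=> su us; have lt : (index (st u) (map st s) < size s)%N.
    by rewrite -(size_map st) index_mem.
  apply/eqP/class_ofP; rewrite su (shuffles_size d (mem_nth _ lt)); split=> //.
  by rewrite -(nth_map _ (st u) st lt) nth_index.
transitivity (\sum_(t <- map st (shuffles p q)) g t).
  rewrite big_map; apply: eq_big_seq => u us; apply: gE.
    exact: shuffles_size us.
  exact: map_f.
rewrite (perm_big _ PE) /= big_map; apply/esym/eq_big_seq => u us; apply: gE.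
  by rewrite (shuffles_size d') // sp sq.
by rewrite (perm_mem PE) map_f.
Qed.

Lemma shuffle_mul_linearl g : linear (shuffle_mul^~ g).
Proof. by move=> a f f'; rewrite /shuffle_mul linearP. Qed.

Lemma shuffle_mul_linearr f : linear (shuffle_mul f).
Proof.
move=> a g g'; rewrite /shuffle_mul /lin_ext scaler_sumr -big_split /=.
apply: eq_bigr => k _; rewrite -!/(lin_ext _ _) linearP scalerDr !scalerA.
by rewrite [a * _]mulrC.
Qed.

Lemma shuffle_mul_classE p q : disjoint_perm p q ->
  shuffle_mul (cls p) (cls q) = \sum_(u <- shuffles p q) cls u.
Proof.
move=> d; rewrite /shuffle_mul !lin_extU.
have [sp tp] := repr_class p; have [sq tq] := repr_class q.
have [sa ta] : size (away (repr (\pi_K p)) (repr (\pi_K q))) = size q /\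
    st (away (repr (\pi_K p)) (repr (\pi_K q))) = st q.
  have so := shift_same_order (max_letter (repr (\pi_K p))) (repr (\pi_K q)).
  by rewrite -(statP st so) -so.1.
by apply: sum_shuffles_class => //; exact: away_disjoint.
Qed.

Lemma shuffle_alg_ind (P : A -> Prop) :
  P 0 -> (forall a p f, P f -> P (a *: cls p + f)) -> forall f, P f.
Proof.
by move=> P0 PD; apply: malg_ind => // a k f Pf; rewrite -[k]reprK; exact: PD.
Qed.

Lemma class_of_shift m p : cls (shift_perm m p) = cls p.
Proof.
have so := shift_same_order m p.
by apply/esym/eqP/class_ofP; split; [exact: so.1 | exact: (statP st so)].
Qed.

Let mulA_disjoint p q r :
  disjoint_perm p q -> disjoint_perm p r -> disjoint_perm q r ->
  shuffle_mul (cls p) (shuffle_mul (cls q) (cls r)) =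
  shuffle_mul (shuffle_mul (cls p) (cls q)) (cls r).
Proof.
move=> pq pr qr.
rewrite (shuffle_mul_classE pq) (shuffle_mul_classE qr)
  (bilin_suml shuffle_mul_linearl) (bilin_sumr shuffle_mul_linearr).
transitivity (\sum_(u <- shuffles q r) \sum_(v <- shuffles p u) cls v).
  apply: eq_big_seq => u /(mem_word_shuffles qr) E; apply: shuffle_mul_classE.
  apply/disjoint_permP => x xp.
  by rewrite E mem_cat negb_or (disjoint_permP _ _ pq) // (disjoint_permP _ _ pr).
rewrite -big_shuffles3 //.
apply: eq_big_seq => u /(mem_word_shuffles pq) E; apply/esym/shuffle_mul_classE.
by apply/disjoint_permP => x; rewrite E mem_cat => /orP[]; apply/disjoint_permP.
Qed.

Let mulA_class p q r : shuffle_mul (cls p) (shuffle_mul (cls q) (cls r)) =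
  shuffle_mul (shuffle_mul (cls p) (cls q)) (cls r).
Proof.
have pq := away_disjoint p q; move: (class_of_shift (max_letter p) q) pq.
rewrite -/(away p q); move: (away p q) => q' <- pq.
pose m := (max_letter p + max_letter q')%N.
rewrite -(class_of_shift m r).
apply: mulA_disjoint => //; apply: shift_disjoint; first exact: leq_addr.
exact: leq_addl.
Qed.

Let mulA : associative shuffle_mul :=
  bilin_assoc shuffle_alg_ind shuffle_mul_linearl shuffle_mul_linearr mulA_class.

Let mul1l : left_id (cls wperm0) shuffle_mul.
Proof.
apply: (bilin_left_id shuffle_alg_ind shuffle_mul_linearr) => p.
by rewrite (shuffle_mul_classE (disjoint0p p)) shuffles0p big_seq1.
Qed.

Let mul1r : right_id (cls wperm0) shuffle_mul.
Proof.
apply: (bilin_right_id shuffle_alg_ind shuffle_mul_linearl) => p.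
by rewrite (shuffle_mul_classE (disjointp0 p)) shufflesp0 big_seq1.
Qed.

Let one_neq0 : cls wperm0 != 0.
Proof. by rewrite monalgU_eq0 oner_eq0. Qed.

HB.instance Definition _ := GRing.Zmodule_isNzRing.Build A
  mulA mul1l mul1r
  (bilinDl shuffle_mul_linearl) (bilinDr shuffle_mul_linearr) one_neq0.

HB.instance Definition _ := GRing.Lmodule_isLalgebra.Build rat A
  (fun a f g => esym (bilinZl shuffle_mul_linearl a f g)).

HB.instance Definition _ := GRing.Lalgebra_isAlgebra.Build rat A
  (fun a f g => esym (bilinZr shuffle_mul_linearr a f g)).

Lemma class_of1 : cls wperm0 = 1.
Proof. by []. Qed.

Lemma class_ofM p q : disjoint_perm p q ->
  cls p * cls q = \sum_(u <- shuffles p q) cls u.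
Proof. exact: shuffle_mul_classE. Qed.

End ShuffleAlgebra.

(* Indices are 0-based: i ranges over 1, ..., |p| - 2. *)
Definition peaks (p : seq nat) : nat :=
  count (fun i => (nth 0 p i.-1 < nth 0 p i)%N && (nth 0 p i.+1 < nth 0 p i)%N)
        (iota 1 (size p - 2)).

Lemma peaks_same_order (p q : wperm) : same_order p q -> peaks p = peaks q.
Proof.
move=> [s H]; rewrite /peaks -s; apply: eq_in_count => i; rewrite mem_iota => ip.
by rewrite !H //; lia.
Qed.

Definition pk : statistic nat :=
  @Statistic nat (fun p : wperm => peaks p) peaks_same_order.

(* A power series in t is its sequence of coefficients; the pointwise product
   of functions is the Hadamard product, with unit 1 / (1 - t). *)
Definition hadamard := nat -> rat.
HB.instance Definition _ := GRing.ComNzRing.on hadamard.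

Lemma hadamardM (f g : hadamard) n : (f * g) n = f n * g n.
Proof. by []. Qed.

(* The expansion in powers of t of the rational function p / q, for q(0) <> 0,
   with respect to the ordinary product of power series:
   p / q = p / q(0) * \sum_k (1 - q / q(0))^k, in which only the terms k <= n
   contribute to the coefficient of t^n. It is characterised by [series_divP]. *)
Definition series_div (p q : {poly rat}) : hadamard := fun n =>
  (p * \sum_(k < n.+1) (1 - (q`_0)^-1 *: q) ^+ k)`_n / q`_0.

Lemma series_divP (p q : {poly rat}) : q`_0 != 0 ->
  forall n, \sum_(i < n.+1) q`_i * series_div p q (n - i)%N = p`_n.
Proof.
move=> q0 n; pose u := 1 - (q`_0)^-1 *: q.
have uX k : exists w, u ^+ k = 'X^k * w.
  suff [w Ew] : exists w, u = 'X * w by exists (w ^+ k); rewrite Ew exprMn.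
  exists (drop_poly 1 u); rewrite -{1}[u](poly_take_drop 1) mulrC expr1.
  suff -> : take_poly 1 u = 0 by rewrite add0r.
  apply/polyP => i; rewrite coef_take_poly coef0; case: i => //=.
  by rewrite /u coefB coefZ coef1 mulVf // subrr.
pose S := p * \sum_(k < n.+1) u ^+ k.
have trunc m : (m <= n)%N -> series_div p q m = S`_m / q`_0.
  move=> mn; rewrite /series_div -/u /S; congr (_ / _).
  rewrite !mulr_sumr !coef_sum.
  rewrite -!(big_mkord xpredT (fun k => (p * u ^+ k)`_m)).
  rewrite [RHS](@big_cat_nat _ _ _ m.+1) //= [X in _ = _ + X]big_nat_cond.
  rewrite [X in _ = _ + X]big1 ?addr0 // => k /andP[/andP[mk _] _].
  by have [w ->] := uX k; rewrite mulrCA coefXnM mk.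
transitivity ((q * S)`_n / q`_0).
  rewrite coefM mulr_suml; apply: eq_bigr => i _.
  by rewrite trunc ?leq_subr // mulrA.
have qE : q = q`_0 *: (1 - u).
  by rewrite /u opprB addrC subrK scalerA divff // scale1r.
have [w Ew] := uX n.+1.
rewrite {1}qE -scalerAl coefZ mulrAC divff // mul1r /S mulrCA.
by rewrite -opprB mulNr -subrX1 opprB Ew mulrBr mulr1 coefB mulrCA coefXnM ltnSn subr0.
Qed.

(* {poly hadamard} is an algebra over hadamard only; the copy below carries the
   structure of Q-algebra. *)
Definition hpoly := {poly hadamard}.
HB.instance Definition _ := GRing.ComNzRing.copy hpoly {poly hadamard}.

Definition hconst (a : rat) : hadamard := fun=> a.

Definition hpoly_scale (a : rat) (P : hpoly) : hpoly :=
  ((hconst a)%:P : {poly hadamard}) * P.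

Lemma hpoly_scaleA a b P : hpoly_scale a (hpoly_scale b P) = hpoly_scale (a * b) P.
Proof. by rewrite /hpoly_scale mulrA -polyCM. Qed.
Lemma hpoly_scale1 : left_id 1 hpoly_scale.
Proof. by move=> P; rewrite /hpoly_scale (_ : hconst 1 = 1) // mul1r. Qed.
Lemma hpoly_scaleDr : right_distributive hpoly_scale +%R.
Proof. by move=> a P Q; exact: mulrDr. Qed.
Lemma hpoly_scaleDl P : {morph hpoly_scale^~ P : a b / a + b}.
Proof.
move=> a b; rewrite /hpoly_scale (_ : hconst (a + b) = hconst a + hconst b) //.
by rewrite polyCD mulrDl.
Qed.

HB.instance Definition _ := GRing.Zmodule_isLmodule.Build rat hpoly
  hpoly_scaleA hpoly_scale1 hpoly_scaleDr hpoly_scaleDl.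

Lemma hpoly_scalerAl (a : rat) (P Q : hpoly) : a *: (P * Q) = (a *: P) * Q.
Proof. exact: mulrA. Qed.
HB.instance Definition _ := GRing.Lmodule_isLalgebra.Build rat hpoly hpoly_scalerAl.

Lemma hpoly_scalerAr (a : rat) (P Q : hpoly) : a *: (P * Q) = P * (a *: Q).
Proof. exact: mulrCA. Qed.
HB.instance Definition _ := GRing.Lalgebra_isAlgebra.Build rat hpoly hpoly_scalerAr.

Lemma coef_hpolyZ (a : rat) (P : hpoly) i n : (a *: P)`_i n = a * P`_i n.
Proof. by rewrite [a *: P]/(_ * _ : {poly hadamard}) coefCM. Qed.

(* The variable of the rational function is t and the outer one is x. It is only
   used for 2j+1 <= n, where the subtraction of natural numbers is exact. *)
Definition pk_series (n j : nat) : hpoly :=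
  (series_div (2%:R ^+ (2 * j + 1) *: ('X^(j + 1) * (1 + 'X) ^+ (n - 2 * j - 1)))
              ((1 - 'X) ^+ (n + 1)))%:P * 'X^n.

Definition geom_series : hpoly := (series_div 1 (1 - 'X))%:P.

Definition pk_image (p : wperm) : hpoly :=
  if size p is 0 then geom_series else pk_series (size p) (pk p).

Local Open Scope classical_set_scope.

Definition lspan (V : lmodType rat) (S : set V) : set V :=
  [set v | exists (n : nat) (c : 'I_n -> rat) (b : 'I_n -> V),
     (forall i, S (b i)) /\ v = \sum_(i < n) c i *: b i].

Definition has_dim (V : lmodType rat) (U : set V) (d : nat) : Prop :=
  exists b : 'I_d -> V,
    (forall c : 'I_d -> rat, \sum_(i < d) c i *: b i = 0 -> forall i, c i = 0) /\
    U = lspan (range b).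

Definition subalgebra (B : algType rat) (U : set B) : Prop :=
  GRing.subalg_closed (mem U).

Definition iso_onto (A B : algType rat) (phi : {lrmorphism A -> B}) (U : set B) :
  Prop := injective phi /\ range phi = U.

Definition homog_component (T : eqType) (st : statistic T)
  (hst : shuffle_compatible st) (n : nat) : set (shuffle_alg hst) :=
  lspan [set f | exists2 p : wperm, size p = n & f = class_of hst p].
Arguments homog_component {T st} hst n.

Definition pk_series_span : set hpoly :=
  lspan ([set geom_series] `|`
         [set P | exists n j : nat,
            [/\ (1 <= n)%N, (j <= (n - 1) %/ 2)%N & P = pk_series n j]]).

Import mpoly.

(* monalg and mpoly give different meanings to {mpoly _[_]}, hence the explicit
   type. *)
Notation Qpx := (mpoly 2 rat).

Definition var_p : Qpx := 'X_ord0.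
Definition var_x : Qpx := 'X_ord_max.

Definition pk_poly_span : set Qpx :=
  lspan ([set (1 : Qpx)] `|`
         [set P : Qpx | exists n j : nat,
            [/\ (1 <= n)%N, (1 <= j <= n)%N, (j = n %[mod 2])%N &
                P = var_p ^+ j * var_x ^+ n]]).

(* Main.v *)
Require Import Defs.
From HB Require Import structures.
From mathcomp Require Import all_boot all_order all_algebra generic_quotient.
From mathcomp Require Import finmap boolp classical_sets functions.
From mathcomp.multinomials Require Import mpoly monalg.
From mathcomp Require Import zify ring.

(* Following Stembridge, let [opc m w] be the number of enriched P-partitions of
   the chain w with values in {-1, 1, ..., -m, m}. These numbers are the m-th
   convolution power, for deconcatenation, of the function counting the ways to
   cut w into a decreasing and an increasing word. Indicators of increasing and of
   decreasing words are characters of the shuffle product, and convolution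
   preserves characters, so [opc m] is one for every m. A recurrence on the first
   letter identifies sum_m opc m w t^m with the series of the theorem, which
   depends only on |w| and pk w; for fixed |w| these series are linearly
   independent, which yields shuffle-compatibility and the isomorphism with the
   span of the series.

   Let f_(n,j) denote the m-th coefficient as a function of m. From
   (1-t)^2 = (1+t)^2 - 4t we get f_(n,j) = f_(n+2,j) - f_(n+2,j+1), and (2m)^n is
   a sum of n! of the f_(n,j), as the n-th power of the one-letter class. By
   induction on n in steps of 2, the f_(n,j) span the same space as the powers m^i
   with 1 <= i <= n and i = n mod 2, whence the polynomial model. *)

Set Implicit Arguments.
Unset Strict Implicit.
Unset Printing Implicit Defensive.

Import GRing.Theory Num.Theory.
Local Open Scope ring_scope.

(** * Shuffles and deconcatenation of words *)

(** The nested fixpoint reflects that each step shortens only one of the two words. The result is a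
    list with multiplicities. *)
Fixpoint word_shuffles (T : Type) (s t : seq T) {struct s} : seq (seq T) :=
  if s is a :: s' then
    (fix shuffles_s t := if t is b :: t' then
       map (cons a) (word_shuffles s' t) ++ map (cons b) (shuffles_s t')
     else [:: s]) t
  else [:: t].

Fixpoint splits (T : Type) (s : seq T) : seq (seq T * seq T) :=
  if s is a :: s' then
    ([::], s) :: map (fun x => (a :: x.1, x.2)) (splits s')
  else [:: ([::], [::])].

Section Words.
Variable T : eqType.
Implicit Types (s t u : seq T) (x y : seq T * seq T).

Lemma word_shuffless0 s : word_shuffles s [::] = [:: s].
Proof. by case: s. Qed.

Lemma word_shuffles_cons a s b t : word_shuffles (a :: s) (b :: t) =
  map (cons a) (word_shuffles s (b :: t)) ++ map (cons b) (word_shuffles (a :: s) t).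
Proof. by []. Qed.

Lemma word_shuffles_ind (P : seq T -> seq T -> Prop) :
  (forall t, P [::] t) -> (forall s, P s [::]) ->
  (forall a s b t, P s (b :: t) -> P (a :: s) t -> P (a :: s) (b :: t)) ->
  forall s t, P s t.
Proof. by move=> P0s Ps0 PS; elim=> // a s IHs; elim=> // b t IHt; apply: PS. Qed.

Lemma splits_cat s x : x \in splits s -> x.1 ++ x.2 = s.
Proof.
elim: s x => [|a s IH] x /=; first by rewrite mem_seq1 => /eqP->.
by rewrite in_cons => /predU1P[-> //|/mapP[y /IH <- ->]].
Qed.

Lemma perm_word_shuffles s t u : u \in word_shuffles s t -> perm_eq u (s ++ t).
Proof.
move: s t u; apply: word_shuffles_ind => [t|s|a s b t IH1 IH2] u.
- by rewrite inE => /eqP->.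
- by rewrite word_shuffless0 inE cats0 => /eqP->.
rewrite word_shuffles_cons mem_cat => /orP[] /mapP[v].
  by move=> /IH1 pv ->; rewrite /= perm_cons.
move=> /IH2 pv ->; rewrite -[b :: t]cat1s perm_sym perm_catCA /= perm_cons.
by rewrite perm_sym.
Qed.

Lemma subseq_word_shuffles s t u : u \in word_shuffles s t ->
  subseq s u && subseq t u.
Proof.
move: s t u; apply: word_shuffles_ind => [t|s|a s b t IH1 IH2] u.
- by rewrite inE => /eqP->; rewrite sub0seq subseq_refl.
- by rewrite word_shuffless0 inE => /eqP->; rewrite sub0seq subseq_refl.
rewrite word_shuffles_cons mem_cat => /orP[] /mapP[v].
  move=> /IH1/andP[s1 s2] ->; rewrite [subseq (a :: s) _]/= eqxx s1 andTb.
  by apply: (subseq_trans s2); exact: subseq_cons.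
move=> /IH2/andP[s1 s2] ->; rewrite [subseq (b :: t) _]/= eqxx s2 andbT.
by apply: (subseq_trans s1); exact: subseq_cons.
Qed.

Lemma word_shuffles_uniq s t : uniq (s ++ t) -> uniq (word_shuffles s t).
Proof.
move: s t; apply: word_shuffles_ind => [t|s|a s b t IH1 IH2] //.
  by rewrite word_shuffless0.
move=> U; rewrite word_shuffles_cons cat_uniq.
rewrite !map_inj_uniq; try by move=> ? ? [].
rewrite IH1; last by case/andP: U.
rewrite IH2; last first.
  by apply: subseq_uniq U; rewrite cat_subseq // subseq_cons.
rewrite andbT; apply/hasPn => _ /mapP[v _ ->]; apply/mapP => -[w _ [ab _]].
by move: U; rewrite -ab /= mem_cat inE eqxx orbT.
Qed.

(** The first letter of [u] lies in exactly one of [s] and [t], and it heads that word, since a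
    later position would make it occur twice in [u]. Removing it gives the induction. *)
Lemma mem_word_shuffles_perm s t u : uniq (s ++ t) -> perm_eq u (s ++ t) ->
  subseq s u -> subseq t u -> u \in word_shuffles s t.
Proof.
elim: u s t => [|c u IH] s t.
  by move=> _ /perm_size; case: s => // _; case: t.
move=> U P.
have Uc : uniq (c :: u) by rewrite (perm_uniq P).
have cst : c \in s ++ t by rewrite -(perm_mem P) mem_head.
have head_eq (r : seq T) : c \in r -> subseq r (c :: u) -> exists2 r', r = c :: r' & subseq r' u.
  case: r => //= d r; case: eqP => [-> _ sr|dc cr sr]; first by exists r.
  by move: (mem_subseq sr cr) Uc => /= ->.
have notin (r : seq T) : c \notin r -> subseq r (c :: u) -> subseq r u.
  case: r => [|d r]; rewrite ?sub0seq // in_cons negb_or eq_sym => /andP[/negPf dc _].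
  by rewrite /= dc.
move: cst; rewrite mem_cat => /orP[cs|ct] ss st.
  have [s' sE ss'] := head_eq _ cs ss; subst s.
  have ct : c \notin t by move: U; rewrite /= mem_cat negb_or => /andP[/andP[]].
  case: t U P st ct => [|b t] U P st ct.
    rewrite word_shuffless0 mem_seq1; apply/eqP; congr (_ :: _).
    move: P; rewrite cats0 perm_cons => /perm_size eu.
    by apply/esym/eqP; rewrite -(size_subseq_leqif ss') eu.
  rewrite word_shuffles_cons mem_cat; apply/orP; left; apply: map_f.
  by apply: IH => //; [case/andP: U | move: P; rewrite /= perm_cons | exact: notin].
have [t' tE st'] := head_eq _ ct st; subst t.
have cs : c \notin s.
  by move: U; rewrite uniq_catC /= mem_cat negb_or => /andP[/andP[]].
have P' : perm_eq u (s ++ t').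
  by move: P; rewrite -[c :: t']cat1s perm_sym perm_catCA /= perm_cons perm_sym.
case: s U P ss cs P' => [|a s] U P ss cs P'.
  rewrite mem_seq1; apply/eqP; congr (_ :: _).
  by apply/esym/eqP; rewrite -(size_subseq_leqif st') (perm_size P').
rewrite word_shuffles_cons mem_cat; apply/orP; right; apply: map_f.
apply: IH => //; last exact: notin.
by apply: subseq_uniq U; rewrite cat_subseq // subseq_cons.
Qed.

Definition conv (f g : seq T -> rat) (s : seq T) : rat :=
  \sum_(x <- splits s) f x.1 * g x.2.

Definition shuffle_sum (f : seq T -> rat) (s t : seq T) : rat :=
  \sum_(u <- word_shuffles s t) f u.

(** Distinctness matters: for s = t = a, the indicator of strictly increasing words has product 1
    but shuffle sum 0. *)
Definition shuffle_char (f : seq T -> rat) : Prop := forall s t,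
  uniq (s ++ t) -> f s * f t = shuffle_sum f s t.

Lemma shuffle_sum0s f t : shuffle_sum f [::] t = f t.
Proof. exact: big_seq1. Qed.

Lemma shuffle_sums0 f s : shuffle_sum f s [::] = f s.
Proof. by rewrite /shuffle_sum word_shuffless0 big_seq1. Qed.

Lemma shuffle_sum_cons f a s b t : shuffle_sum f (a :: s) (b :: t) =
  shuffle_sum (fun u => f (a :: u)) s (b :: t) +
  shuffle_sum (fun u => f (b :: u)) (a :: s) t.
Proof. by rewrite /shuffle_sum word_shuffles_cons big_cat !big_map. Qed.

Lemma shuffle_sumC f s t : shuffle_sum f s t = shuffle_sum f t s.
Proof.
move: s t f; apply: word_shuffles_ind => [t|s|a s b t IH1 IH2] f.
- by rewrite shuffle_sum0s shuffle_sums0.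
- by rewrite shuffle_sum0s shuffle_sums0.
by rewrite !shuffle_sum_cons IH1 IH2 addrC.
Qed.

Lemma big_splits0 (F : seq T * seq T -> rat) :
  \sum_(x <- splits [::]) F x = F ([::], [::]).
Proof. exact: big_seq1. Qed.

Lemma big_splits_cons (F : seq T * seq T -> rat) a s :
  \sum_(x <- splits (a :: s)) F x =
  F ([::], a :: s) + \sum_(x <- splits s) F (a :: x.1, x.2).
Proof. by rewrite /= big_cons big_map. Qed.

Lemma conv_cons f g a s :
  conv f g (a :: s) = f [::] * g (a :: s) + conv (fun u => f (a :: u)) g s.
Proof. exact: big_splits_cons. Qed.

(* Deconcatenation is a morphism for the shuffle product. *)
Lemma shuffle_sum_conv f g s t :
  shuffle_sum (conv f g) s t =
  \sum_(x <- splits s) \sum_(y <- splits t)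
    shuffle_sum f x.1 y.1 * shuffle_sum g x.2 y.2.
Proof.
move: s t f; apply: word_shuffles_ind => [t|s|a s b t IH1 IH2] f.
- rewrite big_splits0 shuffle_sum0s; apply: eq_bigr => y _.
  by rewrite !shuffle_sum0s.
- rewrite shuffle_sums0; apply: eq_bigr => x _.
  by rewrite big_splits0 !shuffle_sums0.
have split_head c u h : shuffle_sum (fun u => conv f g (c :: u)) h u =
    f [::] * shuffle_sum (fun u => g (c :: u)) h u +
    shuffle_sum (conv (fun u => f (c :: u)) g) h u.
  rewrite /shuffle_sum mulr_sumr -big_split; apply: eq_bigr => v _.
  exact: conv_cons.
(* The cuts of [a :: s] and [b :: t] form four blocks, according to which prefixes are empty. If
   neither is, the shuffles of the prefixes are split by their first letter. *)
rewrite shuffle_sum_cons !split_head IH1 IH2 !big_splits_cons /= shuffle_sum0s.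
rewrite [shuffle_sum g _ _]shuffle_sum_cons.
under [X in _ + X + _ = _]eq_bigr do rewrite big_cons big_map /= shuffle_sums0.
under [X in _ = _ + X]eq_bigr do rewrite big_cons big_map /= shuffle_sums0.
rewrite !big_split /=.
under [X in _ = _ + (_ + X)]eq_bigr do under eq_bigr do
  rewrite shuffle_sum_cons mulrDl.
under [X in _ = _ + (_ + X)]eq_bigr do rewrite big_split.
rewrite big_split /=.
under [X in _ + (_ + (X + _)) = _]eq_bigr do rewrite shuffle_sum0s.
under [X in _ = (_ + X) + _]eq_bigr do rewrite shuffle_sum0s.
ring.
Qed.

(** By [shuffle_sum_conv] the shuffle sum factors over the cuts of [s] and [t], whose pieces still
    have distinct letters. *)
Lemma conv_shuffle_char f g :
  shuffle_char f -> shuffle_char g -> shuffle_char (conv f g).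
Proof.
move=> fch gch s t U; rewrite shuffle_sum_conv /conv mulr_suml.
apply: eq_big_seq => x /splits_cat xs; rewrite mulr_sumr.
apply: eq_big_seq => y /splits_cat yt.
move: U; rewrite -xs -yt => U.
have U1 : uniq (x.1 ++ y.1).
  by apply: subseq_uniq U; apply: cat_subseq; exact: prefix_subseq.
have U2 : uniq (x.2 ++ y.2).
  by apply: subseq_uniq U; apply: cat_subseq; exact: suffix_subseq.
by rewrite -fch // -gch //; ring.
Qed.

End Words.

(** * Indicators of monotone words *)

Section Sorted.
Variables (T : eqType) (r : rel T).
Hypotheses (r_trans : transitive r) (r_irr : irreflexive r).
Hypothesis r_total : forall a b, a != b -> r a b || r b a.

Definition sorted_ind (s : seq T) : rat := (sorted r s)%:R.

Lemma sorted_ind_cons a s :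
  sorted_ind (a :: s) = (all (r a) s)%:R * sorted_ind s.
Proof. by rewrite /sorted_ind /= path_sortedE // -natrM mulnb. Qed.

Lemma sorted_ind0 a b s : r a b -> a \in s -> sorted_ind (b :: s) = 0.
Proof.
move=> rab ras; rewrite sorted_ind_cons; case: allP => [H|]; last by rewrite mul0r.
by have := r_trans rab (H a ras); rewrite r_irr.
Qed.

(** If [b :: t] is increasing, transitivity puts [a] below all of it, so prepending [a] to a shuffle
    only adds the condition that [a] is below [s]. *)
Lemma sorted_ind_prepend a s b t : r a b ->
  sorted_ind s * sorted_ind (b :: t) = shuffle_sum sorted_ind s (b :: t) ->
  sorted_ind (a :: s) * sorted_ind (b :: t) =
  shuffle_sum (fun u => sorted_ind (a :: u)) s (b :: t).
Proof.
move=> rab IH; transitivity ((all (r a) (s ++ b :: t))%:R *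
    (sorted_ind s * sorted_ind (b :: t))); last first.
  rewrite IH mulr_sumr; apply: eq_big_seq => u /perm_word_shuffles P.
  by rewrite sorted_ind_cons (perm_all _ P).
rewrite sorted_ind_cons -mulrA all_cat; case: (all _ s); last by rewrite !mul0r.
rewrite /= rab mul1r {2 4}/sorted_ind /=; case: (boolP (path r b t)) => [bt|_]; last first.
  by rewrite !mulr0.
have -> : all (r a) t; last by rewrite mul1r.
by apply: sub_all (order_path_min r_trans bt) => c; exact: r_trans.
Qed.

Lemma shuffle_sum_sorted0 a b s t : r a b -> a \in s ++ t ->
  shuffle_sum (fun u => sorted_ind (b :: u)) s t = 0.
Proof.
move=> rab ast; rewrite /shuffle_sum big1_seq // => u /andP[_ us].
by rewrite (sorted_ind0 rab) // (perm_mem (perm_word_shuffles us)).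
Qed.

(* Two increasing words have exactly one increasing shuffle. *)
Lemma sorted_shuffle_char : shuffle_char sorted_ind.
Proof.
apply: word_shuffles_ind => [t|s|a s b t IH1 IH2] U.
- by rewrite shuffle_sum0s mul1r.
- by rewrite shuffle_sums0 mulr1.
have ab : a != b.
  by apply: contraTneq U => ->; rewrite /= mem_cat inE eqxx orbT.
have {}IH1 : sorted_ind s * sorted_ind (b :: t) = shuffle_sum sorted_ind s (b :: t).
  by apply: IH1; case/andP: U.
have {}IH2 : sorted_ind (a :: s) * sorted_ind t = shuffle_sum sorted_ind (a :: s) t.
  by apply: IH2; apply: subseq_uniq U; rewrite cat_subseq // subseq_cons.
(* An increasing shuffle starts with the smaller head; the shuffles starting with the larger one
   contribute 0. *)
rewrite shuffle_sum_cons; case/orP: (r_total ab) => rab.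
  rewrite (sorted_ind_prepend rab IH1) (shuffle_sum_sorted0 rab) ?addr0 //.
  exact: mem_head.
rewrite (shuffle_sum_sorted0 rab) ?mem_cat ?mem_head ?orbT // add0r mulrC.
rewrite (sorted_ind_prepend rab); first exact: shuffle_sumC.
by rewrite mulrC IH2 shuffle_sumC.
Qed.

Lemma conv_sorted_ind1 g a :
  conv sorted_ind g [:: a] = g [:: a] + g [::].
Proof. by rewrite conv_cons /conv big_splits0 /= !mul1r. Qed.

(** The first summand has an empty prefix. A nonempty prefix is [a] followed by any prefix of
    [b :: s] if [r a b], and [a] alone otherwise. *)
Lemma conv_sorted_ind_cons g a b s :
  conv sorted_ind g (a :: b :: s) = g (a :: b :: s) +
    (if r a b then conv sorted_ind g (b :: s) else g (b :: s)).
Proof.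
rewrite conv_cons mul1r conv_cons mul1r; congr (_ + _).
case: ifP => rab.
  rewrite conv_cons mul1r; congr (_ + _); apply: eq_bigr => x _.
  by rewrite /sorted_ind /= rab.
rewrite /conv big1 ?addr0 // => x _.
by rewrite /sorted_ind /= rab mul0r.
Qed.

End Sorted.

(** * Polynomials acting on power series *)

Section SeriesAction.
Implicit Types (p q : {poly rat}) (s : nat -> rat).

(* The coefficients of the ordinary product of q with the power series s. *)
Definition cmul q s : nat -> rat := fun n => \sum_(i < n.+1) q`_i * s (n - i)%N.

(** Reduces identities of [cmul] to products of polynomials, as coefficient n only involves terms of
    [s] of index at most n. *)
Lemma cmul_trunc q s n N : (n < N)%N -> cmul q s n = (q * \poly_(i < N) s i)`_n.
Proof.
move=> nN; rewrite coefM; apply: eq_bigr => i _; rewrite coef_poly.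
by rewrite (leq_ltn_trans (leq_subr _ _) nN).
Qed.

Lemma cmulM p q s : cmul (p * q) s = cmul p (cmul q s).
Proof.
apply/funext => n; rewrite (cmul_trunc _ _ (ltnSn n)) -mulrA coefM.
by apply: eq_bigr => i _; rewrite -cmul_trunc // ltnS leq_subr.
Qed.

Lemma cmulDl p q s n : cmul (p + q) s n = cmul p s n + cmul q s n.
Proof. by rewrite !(cmul_trunc _ _ (ltnSn n)) mulrDl coefD. Qed.

Lemma cmulNl q s n : cmul (- q) s n = - cmul q s n.
Proof. by rewrite !(cmul_trunc _ _ (ltnSn n)) mulNr coefN. Qed.

Lemma cmulC (a : rat) s n : cmul a%:P s n = a * s n.
Proof.
by rewrite (cmul_trunc _ _ (ltnSn n)) coefCM coef_poly ltnSn.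
Qed.

Lemma cmul_coef p q : cmul p (nth 0 q) = nth 0 (p * q).
Proof.
apply/funext => k; rewrite (cmul_trunc _ _ (ltnSn k)) !coefM.
by apply: eq_bigr => i _; rewrite coef_poly ltnS leq_subr.
Qed.

Lemma cmul1 s n : cmul 1 s n = s n.
Proof. by rewrite cmulC mul1r. Qed.

Lemma cmulX0 s : cmul 'X s 0 = 0.
Proof. by rewrite (cmul_trunc _ _ (ltnSn 0)) coefXM. Qed.

Lemma cmulXS s n : cmul 'X s n.+1 = s n.
Proof. by rewrite (cmul_trunc _ _ (ltnSn _)) coefXM coef_poly /= ltnW. Qed.

Definition cmulE := (cmulM, cmulDl, cmulNl, cmul1, cmulC, cmulX0, cmulXS).

Lemma cmul_sumr (I : Type) (r : seq I) (F : I -> nat -> rat) q n :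
  cmul q (fun m => \sum_(i <- r) F i m) n = \sum_(i <- r) cmul q (F i) n.
Proof.
by rewrite /cmul exchange_big; apply: eq_bigr => i _; rewrite mulr_sumr.
Qed.

Lemma cmulZr q (a : rat) s n : cmul q (fun m => a * s m) n = a * cmul q s n.
Proof. by rewrite /cmul mulr_sumr; apply: eq_bigr => i _; rewrite mulrCA. Qed.

Lemma cmulBr q s s' n : cmul q (fun m => s m - s' m) n = cmul q s n - cmul q s' n.
Proof. by rewrite /cmul -sumrB; apply: eq_bigr => i _; rewrite mulrBr. Qed.

Lemma cmul_inj q : q`_0 != 0 -> injective (cmul q).
Proof.
move=> q0 s s' E; apply/funext => n; have [k le] := ubnP n.
elim: k n le => // k IH n nk.
have := congr1 (@^~ n) E; rewrite /cmul !big_ord_recl /= subn0.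
rewrite (eq_bigr (fun i : 'I_n => q`_(lift ord0 i) * s' (n - lift ord0 i)%N)).
  by move/addIr/(mulfI q0).
by move=> i _; rewrite IH //= /bump /=; have := ltn_ord i; lia.
Qed.

Lemma cmul_series_div p q : q`_0 != 0 -> cmul q (series_div p q) = nth 0 p.
Proof. by move=> q0; apply/funext => n; exact: series_divP. Qed.

End SeriesAction.

Lemma coef0_1subX n : ((1 - 'X : {poly rat}) ^+ n)`_0 = 1.
Proof. by rewrite -horner_coef0 horner_exp !hornerE ?oppr0 ?addr0 ?expr1n. Qed.

(** * Enriched P-partitions *)

(* The number of enriched P-partitions of the chain w with values in
   {-1, 1, ..., -m, m}, ordered as -1 < 1 < -2 < 2 < ... *)
Fixpoint opc (m : nat) : seq nat -> rat :=
  if m is m'.+1 then conv (sorted_ind gtn) (conv (sorted_ind ltn) (opc m'))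
  else fun w => (w == [::])%:R.

(* Allows in addition a least value 0, which behaves like the positive ones. *)
Definition opc_half (m : nat) : seq nat -> rat := conv (sorted_ind ltn) (opc m).

Lemma opc_shuffle_char m : shuffle_char (opc m).
Proof.
elim: m => [|m IH] /=.
  move=> [|a s] [|b t] _; rewrite ?shuffle_sum0s ?shuffle_sums0 ?mul1r ?mul0r //.
  rewrite shuffle_sum_cons /shuffle_sum !big1 ?addr0 //.
apply: conv_shuffle_char; last apply: conv_shuffle_char => //.
  apply: sorted_shuffle_char.
  - by move=> a b c /= ba ac; apply: ltn_trans ba.
  - by move=> a /=; rewrite ltnn.
  - by move=> a b; rewrite /= neq_ltn orbC.
apply: sorted_shuffle_char; first exact: ltn_trans.
  exact: ltnn.
by move=> a b; rewrite neq_ltn.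
Qed.

Lemma opc0_cons a w : opc 0 (a :: w) = 0.
Proof. by []. Qed.

Lemma opcS m w : opc m.+1 w = conv (sorted_ind gtn) (opc_half m) w.
Proof. by []. Qed.

Lemma opc_nil m : opc m [::] = 1.
Proof. by elim: m => //= m IH; rewrite /conv !big_splits0 /= IH !mulr1. Qed.

Lemma opc_half_nil m : opc_half m [::] = 1.
Proof. by rewrite /opc_half /conv big_splits0 opc_nil mulr1. Qed.

Lemma opcS_cons m a b w : opc m.+1 (a :: b :: w) = opc_half m (a :: b :: w) +
  (if (b < a)%N then opc m.+1 (b :: w) else opc_half m (b :: w)).
Proof. by rewrite !opcS conv_sorted_ind_cons. Qed.

Lemma opc_half_cons m a b w : opc_half m (a :: b :: w) = opc m (a :: b :: w) +
  (if (a < b)%N then opc_half m (b :: w) else opc m (b :: w)).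
Proof. by rewrite /opc_half conv_sorted_ind_cons. Qed.

Lemma opcS1 m a : opc m.+1 [:: a] = opc m [:: a] + 2%:R.
Proof.
by rewrite opcS conv_sorted_ind1 /opc_half conv_sorted_ind1 -/(opc_half _ _)
  opc_half_nil opc_nil -addrA.
Qed.

Lemma opc_half1 m a : opc_half m [:: a] = opc m [:: a] + 1.
Proof. by rewrite /opc_half conv_sorted_ind1 opc_nil. Qed.

Lemma peaks_cons3 a b c w :
  peaks (a :: b :: c :: w) = ((a < b) && (c < b) + peaks (b :: c :: w))%N.
Proof.
rewrite /peaks /= !subn2 /= -[2%N]/(1 + 1)%N iotaDl count_map; congr addn.
by apply: eq_in_count => i; rewrite mem_iota; case: i.
Qed.

(** The letter in front of [b] matters only by being smaller, so 0 can stand for it. *)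
Lemma peaks_ascent a b w : (0 < b)%N -> (a < b)%N -> peaks (a :: b :: w) = peaks (0 :: b :: w)%N.
Proof. by case: w => [|c w] b0 ab //; rewrite !peaks_cons3 b0 ab. Qed.

Lemma peaks_descent a b w : (b < a)%N -> peaks (a :: b :: w) = peaks (b :: w).
Proof. by case: w => [|c w] ab //; rewrite peaks_cons3 ltnNge (ltnW ab). Qed.

(** The numerator in [pk_series]; the subtraction is exact for 2j + 1 <= n. *)
Definition pk_num (n j : nat) : {poly rat} :=
  2%:R ^+ (2 * j + 1) *: ('X^(j + 1) * (1 + 'X) ^+ (n - 2 * j - 1)).

(* [opc_half] is governed by the peaks of the word preceded by a letter 0. *)
Definition pk_half_num (n j : nat) : {poly rat} :=
  2%:R ^+ (2 * j) *: ('X^j * (1 + 'X) ^+ (n - 2 * j)).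

(** One step of the recurrence on the first letter, with denominators cleared: a letter adds a
    factor 1 - t to the denominator and [p] to the numerator. *)
Lemma cmul_step n (s s' : nat -> rat) (p g : {poly rat}) :
  cmul (1 - 'X) s = cmul p s' -> cmul ((1 - 'X) ^+ n) s' = nth 0 g ->
  cmul ((1 - 'X) ^+ n.+1) s = nth 0 (p * g).
Proof.
by move=> E E'; rewrite exprSr cmulM E -cmulM mulrC cmulM E' cmul_coef.
Qed.

(** This and the next three lemmas give the numerator factors for a prepended letter: the first two
    for an ascent, the last two for a descent. *)
Lemma pk_numS_half n j : (2 * j <= n)%N ->
  pk_num n.+1 j = 2%:R *: 'X * pk_half_num n j.
Proof.
move=> jn; rewrite /pk_num /pk_half_num (_ : n.+1 - 2 * j - 1 = n - 2 * j)%N; last lia.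
by rewrite !addn1 -scalerAl -scalerAr scalerA -exprS !exprS mulrA.
Qed.

Lemma pk_half_numS n j : (2 * j <= n)%N ->
  pk_half_num n.+1 j = (1 + 'X) * pk_half_num n j.
Proof. by move=> jn; rewrite /pk_half_num subSn // -scalerAr exprS mulrCA. Qed.

Lemma pk_numS n j : (2 * j + 1 <= n)%N -> pk_num n.+1 j = (1 + 'X) * pk_num n j.
Proof.
move=> jn; rewrite /pk_num (_ : n.+1 - 2 * j - 1 = (n - 2 * j - 1).+1)%N; last lia.
by rewrite -scalerAr exprS mulrCA.
Qed.

Lemma pk_half_numS_num n j : (2 * j + 1 <= n)%N ->
  pk_half_num n.+1 j.+1 = 2%:R%:P * pk_num n j.
Proof.
move=> jn; rewrite /pk_num /pk_half_num.
rewrite (_ : n.+1 - 2 * j.+1 = n - 2 * j - 1)%N; last lia.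
by rewrite mul_polyC scalerA -exprS mulnS addn1 addn1.
Qed.

(** Induction on [w], for both counts at once: if a < b, both series for [a :: b :: w] come from
    [opc_half] of [b :: w], otherwise both come from [opc]. The bounds keep the exponents of 1 + X
    exact, and the 0 in the hypothesis makes the letters positive. *)
Lemma opc_series a w : uniq (0 :: a :: w)%N -> let s := a :: w in
  let n := size s in
  [/\ (2 * peaks s + 1 <= n)%N, (2 * peaks (0%N :: s) <= n)%N,
      cmul ((1 - 'X) ^+ n.+1) (opc ^~ s) = nth 0 (pk_num n (peaks s)) &
      cmul ((1 - 'X) ^+ n.+1) (opc_half ^~ s) =
        nth 0 (pk_half_num n (peaks (0%N :: s)))].
Proof.
elim: w a => [|b w IH] a U /=.
  (* The series of the empty word is 1 / (1 - t). *)
  have E1 : cmul ((1 - 'X) ^+ 1) (fun=> 1) = nth 0 (1 : {poly rat}).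
    apply/funext => -[|n]; rewrite expr1 !cmulE ?subr0 ?subrr ?coef1 //.
  split=> //.
    rewrite (cmul_step (p := 2%:R *: 'X) _ E1).
      by rewrite mulr1 /pk_num /peaks /= mulr1.
    apply/funext => -[|n]; rewrite -mul_polyC !cmulE ?mulr0 ?subr0 //.
    by rewrite opcS1; ring.
  rewrite (cmul_step (p := 1 + 'X) _ E1).
    by rewrite /pk_half_num /peaks /= scale1r mul1r mulr1.
  apply/funext => -[|n]; rewrite !cmulE ?opc_half1 ?opcS1 //=; ring.
have [b0 a0] : (0 < b)%N /\ (0 < a)%N.
  by move: U; rewrite /= !inE !negb_or ![0%N == _]eq_sym -!lt0n => /andP[/and3P[]].
have [] := IH b.
  by move: U; rewrite /= !inE !negb_or => /andP[/and3P[_ -> ->] /andP[_ ->]].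
move=> /= {IH}.
have [ab|ba|ab] := ltngtP a b; last by move: U; rewrite ab /= !inE eqxx /= andbF.
  have nba : (b < a)%N = false by rewrite ltnNge ltnW.
  have -> : peaks [:: 0%N, a, b & w] = peaks (a :: b :: w).
    by rewrite peaks_cons3 nba andbF.
  rewrite peaks_ascent //; set j := peaks (0%N :: b :: w) => _ jn _ EH.
  split; [lia | lia | rewrite pk_numS_half // | rewrite pk_half_numS //].
    (* With G and H the generating series of [opc] and [opc_half], an ascent gives (1 - t) G(a :: b
       :: w) = 2t H(b :: w) and (1 - t) H(a :: b :: w) = (1 + t) H(b :: w). *)
    rewrite (cmul_step (p := 2%:R *: 'X) _ EH) //; apply/funext => -[|n].
      by rewrite -mul_polyC !cmulE opc0_cons; ring.
    by rewrite -mul_polyC !cmulE opcS_cons nba opc_half_cons ab; ring.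
  rewrite (cmul_step (p := 1 + 'X) _ EH) //; apply/funext => -[|n].
    by rewrite !cmulE opc_half_cons ab opc0_cons; ring.
  by rewrite !cmulE opc_half_cons ab opcS_cons nba opc_half_cons ab; ring.
have nab : (a < b)%N = false by rewrite ltnNge ltnW.
rewrite peaks_cons3 a0 ba /= add1n (peaks_descent w ba).
set j := peaks (b :: w) => jn _ EG _.
split; [lia | lia | rewrite pk_numS // | rewrite pk_half_numS_num //].
  (* A descent gives (1 - t) G(a :: b :: w) = (1 + t) G(b :: w) and (1 - t) H(a :: b :: w) = 2 G(b
     :: w). *)
  rewrite (cmul_step (p := 1 + 'X) _ EG) //; apply/funext => -[|n].
    by rewrite !cmulE !opc0_cons; ring.
  by rewrite !cmulE opcS_cons ba opc_half_cons nab; ring.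
rewrite (cmul_step (p := 2%:R%:P) _ EG) //; apply/funext => -[|n].
  by rewrite !cmulE opc_half_cons nab !opc0_cons; ring.
by rewrite !cmulE opc_half_cons nab opcS_cons ba opc_half_cons nab; ring.
Qed.

(** * Shuffle-compatibility *)

(** For n = 0 the unit of [hadamard] is the constant sequence 1, that is, 1 / (1 - t). *)
Definition pk_coef (n j : nat) : hadamard :=
  if n is 0 then 1 else series_div (pk_num n j) ((1 - 'X) ^+ (n + 1)).

Lemma cmul_pk_coef n j : (0 < n)%N ->
  cmul ((1 - 'X) ^+ n.+1) (pk_coef n j) = nth 0 (pk_num n j).
Proof.
case: n => // n _; rewrite /pk_coef addn1 cmul_series_div //.
by rewrite coef0_1subX oner_eq0.
Qed.

Lemma cmul_1subX_inj n : injective (cmul ((1 - 'X) ^+ n)).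
Proof. by apply: cmul_inj; rewrite coef0_1subX oner_eq0. Qed.

Lemma wperm_uniq0 (p : wperm) : uniq (0%N :: p).
Proof.
by rewrite /= wperm_uniq andbT; apply/negP => /(allP (wperm_pos p)).
Qed.

Lemma wperm0P (p : wperm) : size p = 0%N -> p = wperm0.
Proof. by move/size0nil => p0; apply: val_inj. Qed.

Lemma pk_bound (p : wperm) : (0 < size p)%N -> (2 * pk p + 1 <= size p)%N.
Proof.
have := wperm_uniq0 p; rewrite /pk /=.
by case: (word p) => // a w U _; have [] := opc_series U.
Qed.

Lemma opc_pk (p : wperm) m : opc m p = pk_coef (size p) (pk p) m.
Proof.
have := wperm_uniq0 p; rewrite /pk /=.
case: (word p) => [|a w] U; first by rewrite opc_nil.
have [_ _ E _] := opc_series U; rewrite -cmul_pk_coef // in E.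
by have /(congr1 (@^~ m)) := cmul_1subX_inj E.
Qed.

(** Holds also where the exponent of 1 + X is truncated, since the constant term of its power is
    still 1. This allows the crude range j < n in [pk_compatible]. *)
Lemma coef_pk_num n j i : (i <= j)%N ->
  (pk_num n j)`_i.+1 = if i == j then 2%:R ^+ (2 * j + 1) else 0.
Proof.
move=> ij; rewrite /pk_num (addn1 j) coefZ coefXnM ltnS.
case: ltngtP ij => // [ij _|-> _]; first by rewrite mulr0.
by rewrite subnn -horner_coef0 horner_exp !hornerE ?addr0 ?expr1n ?mulr1.
Qed.

(* [pk_num n j] has lowest term X^(j+1). *)
Lemma pk_coef_independent n d (c : nat -> rat) : (0 < n)%N ->
  (forall m, \sum_(j < d) c j * pk_coef n j m = 0) ->
  forall j, (j < d)%N -> c j = 0.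
Proof.
move=> n0 H.
(* Multiplying by (1 - t)^(n+1) turns the relation into one between numerators. *)
have E i : \sum_(j < d) c j * (pk_num n j)`_i = 0.
  transitivity (cmul ((1 - 'X) ^+ n.+1) (fun m => \sum_(j < d) c j * pk_coef n j m) i).
    rewrite cmul_sumr; apply: eq_bigr => j _.
    by rewrite cmulZr cmul_pk_coef.
  by rewrite /cmul big1 // => k _; rewrite H mulr0.
elim/ltn_ind => j IH jd; move: (E j.+1).
rewrite (bigD1 (Ordinal jd)) //= coef_pk_num // eqxx big1 ?addr0 => [/eqP|k kj].
  by rewrite mulf_eq0 expf_eq0 pnatr_eq0 andbF orbF => /eqP.
have [kltj|jk] := ltnP k j; first by rewrite IH ?mul0r.
by rewrite coef_pk_num // eq_sym -val_eqE in kj * => //; rewrite (negPf kj) mulr0.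
Qed.

(** Links [shuffles], obtained by filtering permutations, to the recursive list on which characters
    are evaluated. *)
Lemma perm_shuffles (p q : wperm) : disjoint_perm p q ->
  perm_eq (map word (shuffles p q)) (word_shuffles p q).
Proof.
move=> d; apply: uniq_perm.
- by rewrite map_inj_uniq ?shuffles_uniq //; exact: val_inj.
- exact/word_shuffles_uniq/disjoint_uniq.
move=> w; apply/mapP/idP => [[u us ->]|wpq].
  apply: mem_word_shuffles_perm; first exact: disjoint_uniq.
  - apply: uniq_perm; rewrite ?wperm_uniq ?disjoint_uniq //.
    exact: mem_word_shuffles us.
  - by move: us; rewrite mem_shuffles // => /and3P[].
  - by move: us; rewrite mem_shuffles // => /and3P[].
have P := perm_word_shuffles wpq.
have wP : uniq w && all (leq 1) w.
  by rewrite (perm_uniq P) (perm_all _ P) disjoint_uniq // all_cat !wperm_pos.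
exists (WPerm wP) => //; rewrite mem_shuffles // (perm_size P) size_cat eqxx.
exact: subseq_word_shuffles.
Qed.

Lemma opcM (p q : wperm) m : disjoint_perm p q ->
  opc m p * opc m q = \sum_(u <- shuffles p q) opc m u.
Proof.
move=> d; rewrite opc_shuffle_char ?disjoint_uniq // /shuffle_sum.
by rewrite -(perm_big _ (perm_shuffles d)) big_map.
Qed.

Lemma pk_coefM (p q : wperm) m : disjoint_perm p q ->
  pk_coef (size p) (pk p) m * pk_coef (size q) (pk q) m =
  \sum_(u <- shuffles p q) pk_coef (size p + size q) (pk u) m.
Proof.
move=> d; rewrite -!opc_pk opcM //; apply: eq_big_seq => u us.
by rewrite opc_pk (shuffles_size d us).
Qed.

Lemma sum_count (L : seq nat) n (F : nat -> rat) : all (fun j => j < n)%N L ->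
  \sum_(j <- L) F j = \sum_(i < n) (count_mem (i : nat) L)%:R * F i.
Proof.
elim: L => [|j L IH] /= => [_|/andP[jn /IH E]].
  by rewrite big_nil big1 // => i _; rewrite mul0r.
rewrite big_cons E; under [RHS]eq_bigr do rewrite natrD mulrDl.
rewrite big_split /=; congr (_ + _).
rewrite (bigD1 (Ordinal jn)) //= eqxx mul1r big1 ?addr0 // => i.
by rewrite -val_eqE eq_sym => /negPf /= ->; rewrite mul0r.
Qed.

Lemma pk_compatible : shuffle_compatible pk.
Proof.
move=> p q p' q' d d' ep eq sp sq; set n := (size p + size q)%N.
have [n0|n0] := posnP n.
  have [/wperm0P p0 /wperm0P q0] : size p = 0%N /\ size q = 0%N by lia.
  have [/wperm0P p0' /wperm0P q0'] : size p' = 0%N /\ size q' = 0%N by lia.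
  by rewrite p0 q0 p0' q0'.
have pk_lt a b : disjoint_perm a b -> (size a + size b)%N = n ->
    all (fun j => j < n)%N (map pk (shuffles a b)).
  move=> dab sab; apply/allP => _ /mapP[u us ->].
  have su := shuffles_size dab us.
  by have := @pk_bound u; rewrite su sab; lia.
have pk_ltpq := pk_lt p q d erefl.
have pk_ltpq' : all (fun j => j < n)%N (map pk (shuffles p' q')).
  by apply: pk_lt; rewrite // -sp -sq.
apply/allP => j; rewrite mem_cat /= => jpq; apply/eqP.
have jn : (j < n)%N by case/orP: jpq => ?; [apply: (allP pk_ltpq) | apply: (allP pk_ltpq')].
apply/eqP; rewrite -(eqr_nat rat) -subr_eq0; apply/eqP.
(* The differences of multiplicities are coefficients of a linear relation between the
   [pk_coef n i]: both weighted sums equal the product of the series of the two factors. *)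
pose c i : rat := (count_mem i (map pk (shuffles p q)))%:R -
         (count_mem i (map pk (shuffles p' q')))%:R.
apply: (pk_coef_independent (c := c) n0) jn => m.
under eq_bigr do rewrite mulrBl.
have /= E := sum_count (pk_coef n ^~ m) pk_ltpq.
have /= E' := sum_count (pk_coef n ^~ m) pk_ltpq'.
rewrite sumrB -E -E' !big_map; apply/eqP; rewrite subr_eq0; apply/eqP.
by rewrite -pk_coefM // ep eq sp sq pk_coefM // /n sp sq.
Qed.

(** * The shuffle algebra of the peak number *)

Section LinearSpan.
Variable V : lmodType rat.
Implicit Types (S P : set V) (u v : V).

Lemma lspan_sub S v : S v -> lspan S v.
Proof.
by move=> Sv; exists 1%N, (fun=> 1), (fun=> v); split=> //; rewrite big_ord1 scale1r.
Qed.

Lemma lspan0 S : lspan S 0.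
Proof. by exists 0%N, (fun=> 0), (fun=> 0); split=> [[]//|]; rewrite big_ord0. Qed.

Lemma lspan_linear S a u v : lspan S u -> lspan S v -> lspan S (a *: u + v).
Proof.
move=> [n [c [b [Sb ->]]]] [n' [c' [b' [Sb' ->]]]].
exists (n + n')%N, (fun i => match fintype.split i with inl j => a * c j | inr j => c' j end),
  (fun i => match fintype.split i with inl j => b j | inr j => b' j end).
split=> [i|]; first by case: fintype.split.
rewrite big_split_ord scaler_sumr; congr (_ + _); apply: eq_bigr => i _.
  by rewrite (unsplitK (inl i)) scalerA.
by rewrite (unsplitK (inr i)).
Qed.

Lemma lspan_min S P : P 0 -> (forall a u v, P u -> P v -> P (a *: u + v)) ->
  (S `<=` P)%classic -> (lspan S `<=` P)%classic.
Proof.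
move=> P0 Pl SP _ [n [c [b [Sb ->]]]].
elim/big_rec: _ => // i v _; apply: Pl; exact: SP.
Qed.

Lemma lspanS S P : (S `<=` lspan P)%classic -> (lspan S `<=` lspan P)%classic.
Proof.
move=> SP; apply: lspan_min => //; first exact: lspan0.
by move=> a u v; exact: lspan_linear.
Qed.

Lemma lspanD S u v : lspan S u -> lspan S v -> lspan S (u + v).
Proof. by move=> Su Sv; rewrite -[u]scale1r; exact: lspan_linear. Qed.

Lemma lspanZ S a u : lspan S u -> lspan S (a *: u).
Proof. by move=> Su; rewrite -[_ *: _]addr0; apply: lspan_linear => //; exact: lspan0. Qed.

Lemma lspanB S u v : lspan S u -> lspan S v -> lspan S (u - v).
Proof. by move=> Su Sv; rewrite addrC -scaleN1r; exact: lspan_linear. Qed.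

Lemma lspan_sum S (I : eqType) (r : seq I) (F : I -> V) :
  (forall i, i \in r -> lspan S (F i)) -> lspan S (\sum_(i <- r) F i).
Proof.
move=> SF; rewrite big_seq; elim/big_rec: _ => [|i v ir]; first exact: lspan0.
by apply: lspanD; exact: SF.
Qed.

End LinearSpan.

Lemma range_subalgebra (A B : algType rat) (phi : {lrmorphism A -> B}) (U : set B) :
  range phi = U -> subalgebra U.
Proof.
move=> <-; split=> [|a u v|u v]; rewrite ?in_setE.
- by exists 1; rewrite ?rmorph1.
- by move=> [x _ <-] [y _ <-]; exists (a *: x + y); rewrite // linearP.
- by move=> [x _ <-] [y _ <-]; exists (x * y); rewrite // rmorphM.
Qed.

Lemma linear_multiplicative (A B : algType rat) (I : Type) (e : I -> A)
    (f : {linear A -> B}) :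
  (forall P : A -> Prop,
    P 0 -> (forall a i x, P x -> P (a *: e i + x)) -> forall x, P x) ->
  (forall i j, f (e i * e j) = f (e i) * f (e j)) ->
  {morph f : x y / x * y}.
Proof.
move=> Aind fM x y; elim/Aind: x => [|a i x IH]; first by rewrite mul0r linear0 mul0r.
rewrite mulrDl !linearD mulrDl IH; congr (_ + _).
elim/Aind: y {IH} => [|b j y IH]; first by rewrite mulr0 linear0 mulr0.
rewrite mulrDr !linearD mulrDr IH; congr (_ + _).
by rewrite -scalerAl -scalerAr !linearZ /= fM -scalerAl -scalerAr.
Qed.

Lemma wperm_extend (s : seq nat) (p : wperm) :
  uniq s -> all (fun a => max_letter p < a)%N s ->
  exists q : wperm, word q = s ++ p.
Proof.
move=> us /allP ps; suff wP : uniq (s ++ p) && all (leq 1) (s ++ p) by exists (WPerm wP).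
rewrite cat_uniq us wperm_uniq all_cat wperm_pos !andbT; apply/andP; split.
  by apply/hasPn => x /leq_max_letter; apply: contraTN => /ps; rewrite ltnNge.
by apply/allP => x /ps; apply: leq_ltn_trans.
Qed.

(** From one letter, prepend j times M+1, M+2 with M the current maximum, each time creating a peak
    at M+2; then prepend new maxima, which only create descents. *)
Lemma pk_exists n j : (2 * j + 1 <= n)%N -> exists p : wperm, size p = n /\ pk p = j.
Proof.
have lt p b : b \in word p -> (b < (max_letter p).+1)%N by move=> /leq_max_letter.
have base : exists p : wperm, size p = 1%N /\ pk p = 0%N by exists (@WPerm [:: 1%N] isT).
have peak (p : wperm) : (0 < size p)%N ->
    exists q : wperm, size q = (size p).+2 /\ pk q = (pk p).+1.
  move=> p0; set M := max_letter p.
  have [||q qE] := @wperm_extend [:: M.+1; M.+2] p.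
  - by rewrite /= inE andbT neq_ltn ltnSn.
  - by rewrite /= -/M ltnSn leqnSn.
  exists q; rewrite /pk /= qE size_cat; split=> //.
  case: (word p) (lt p) p0 => // c w ltp _; have := ltp _ (mem_head _ _).
  rewrite -/M => cM; rewrite /= peaks_cons3 ltnSn (leq_trans cM) // add1n.
  by rewrite peaks_descent // (leq_trans cM).
have descent (p : wperm) : (0 < size p)%N ->
    exists q : wperm, size q = (size p).+1 /\ pk q = pk p.
  move=> p0; set M := max_letter p.
  have [||q qE] := @wperm_extend [:: M.+1] p => //.
  - by rewrite /= -/M ltnSn.
  exists q; rewrite /pk /= qE size_cat; split=> //.
  case: (word p) (lt p) p0 => // c w ltp _; have := ltp _ (mem_head _ _).
  by rewrite -/M => cM; rewrite /= peaks_descent.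
move=> /subnK <-; elim: (n - _)%N => {n} [|k [p [sp pp]]].
  elim: j => [|j [p [sp pp]]]; first exact: base.
  have [|q [sq pq]] := peak p; first by rewrite sp addn1.
  by exists q; rewrite sq pq sp pp; split=> //; lia.
have [|q [sq pq]] := descent p; first by rewrite sp; lia.
by exists q; rewrite sq pq sp pp.
Qed.

(** * The algebra morphism to series *)

Section PeakMap.
Variable hpk : shuffle_compatible pk.
Local Notation A := (shuffle_alg hpk).
Local Notation cls := (class_of hpk).

Definition pk_map : A -> hpoly := lin_ext (fun k : st_class pk => pk_image (repr k)).

Lemma pk_map_linear : linear pk_map.
Proof. exact: lin_ext_linear. Qed.

HB.instance Definition _ := GRing.isLinear.Build rat A hpoly _ pk_map pk_map_linear.

Lemma pk_map_class (p : wperm) : pk_map (cls p) = pk_image p.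
Proof.
rewrite /pk_map lin_extU; have [sp tp] := repr_class pk p.
by rewrite /pk_image sp tp.
Qed.

Lemma geom_series1 : geom_series = 1.
Proof.
rewrite /geom_series; have -> : series_div 1 (1 - 'X) = 1 :> hadamard => //.
have q0 : (1 - 'X : {poly rat})`_0 != 0.
  by have := coef0_1subX 1; rewrite expr1 => ->; rewrite oner_eq0.
apply: (cmul_inj q0); rewrite cmul_series_div //.
by apply/funext => -[|n]; rewrite !cmulE coef1 ?subrr ?subr0.
Qed.

Lemma pk_imageE (p : wperm) :
  pk_image p = (pk_coef (size p) (pk p))%:P * 'X^(size p).
Proof.
rewrite /pk_image; case: (size p) => [|n] //.
by rewrite geom_series1 expr0 mulr1.
Qed.

Lemma pk_imageM (p q : wperm) : disjoint_perm p q ->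
  pk_image p * pk_image q = \sum_(u <- shuffles p q) pk_image u.
Proof.
move=> d; transitivity (\sum_(u <- shuffles p q)
    (pk_coef (size p + size q) (pk u))%:P * 'X^(size p + size q) : {poly hadamard}).
  rewrite !pk_imageE mulrACA -exprD -polyCM -mulr_suml -rmorph_sum; congr (_%:P * _).
  apply/funext => m; rewrite hadamardM pk_coefM //.
  elim/big_ind2: _ => // x1 x2 y1 y2 -> -> //.
by apply: eq_big_seq => u us; rewrite pk_imageE (shuffles_size d us).
Qed.

Lemma pk_map_monoid_morphism : monoid_morphism pk_map.
Proof.
split; first by rewrite -class_of1 pk_map_class /pk_image /= geom_series1.
apply: (linear_multiplicative (@shuffle_alg_ind _ _ hpk)) => p q.
change (pk_map (cls p * cls q) = pk_map (cls p) * pk_map (cls q)).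
(* The product formula needs disjoint representatives, so [q] is replaced by a shifted copy in its
   class. *)
rewrite -(class_of_shift hpk (max_letter p) q) -/(away p q).
rewrite (class_ofM hpk (away_disjoint p q)) !pk_map_class.
rewrite (pk_imageM (away_disjoint p q)) linear_sum.
by apply: eq_bigr => u _; exact: pk_map_class.
Qed.

HB.instance Definition _ := GRing.isMonoidMorphism.Build A hpoly pk_map
  pk_map_monoid_morphism.

End PeakMap.

Arguments pk_map hpk : clear implicits.

Section PeakIsomorphism.
Variable hpk : shuffle_compatible pk.
Local Notation A := (shuffle_alg hpk).
Local Notation cls := (class_of hpk).
Local Notation phi := (pk_map hpk).
Local Notation coefA f k := (monalg.mcoeff k f).

Lemma pk_seriesE n j : (0 < n)%N -> pk_series n j = (pk_coef n j)%:P * 'X^n.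
Proof. by case: n. Qed.

Lemma pk_lt (p : wperm) : (pk p < maxn (size p) 1)%N.
Proof.
have [p0|p0] := posnP (size p); first by rewrite (wperm0P p0).
by have := pk_bound p0; lia.
Qed.

(** The power of x separates the lengths. *)
Lemma pk_map_coef (f : A) n m :
  (phi f)`_n m = \sum_(k <- msupp (f : {malg rat[st_class pk]}) | size (repr k) == n)
     coefA f k * pk_coef n (pk (repr k)) m.
Proof.
rewrite /pk_map /lin_ext; set s := msupp _.
transitivity (\sum_(k <- s) coefA f k * (pk_image (repr k))`_n m).
  elim/big_ind2: _ => [|P a Q b <- <-|k _]; first by rewrite coef0.
    by rewrite coefD.
  exact: coef_hpolyZ.
rewrite [RHS]big_mkcond; apply: eq_bigr => k _.
rewrite pk_imageE coefMXn coefC; have [->|ne] := eqVneq (size (repr k)) n.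
  by rewrite ltnn subnn.
case: ltnP => [_|le]; first by rewrite mulr0.
by rewrite subn_eq0 leqNgt ltn_neqAle ne le mulr0.
Qed.

Lemma pk_map_inj : injective phi.
Proof.
suff inj0 f : phi f = 0 -> f = 0.
  move=> f g fg; apply/eqP; rewrite -subr_eq0; apply/eqP/inj0.
  by rewrite linearB /= fg subrr.
move=> f0; apply/malgP => k; rewrite monalg.mcoeff0.
pose n := size (repr k).
pose s := msupp (f : {malg rat[st_class pk]}).
(* Groups the coefficients of [f] in length n by peak number; each group contains at most one
   class. *)
pose c j : rat := \sum_(l <- s | (size (repr l) == n) && (pk (repr l) == j)) coefA f l.
have only_k (l : st_class pk) : (size (repr l) == n) && (pk (repr l) == pk (repr k)) = (l == k).
  apply/andP/eqP => [[/eqP sl /eqP pl]|->]; last by rewrite !eqxx.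
  by rewrite -[l]reprK -[k]reprK; apply/eqP/st_classP.
have ck : c (pk (repr k)) = coefA f k.
  rewrite /c (eq_bigl _ _ only_k) big_mkcond; have [ks|ks] := boolP (k \in s).
    rewrite (bigD1_seq k) ?fset_uniq //= eqxx big1 ?addr0 // => l lk.
    by rewrite (negPf lk).
  rewrite big1_seq ?(monalg.mcoeff_outdom ks) // => l /andP[_ ls].
  by case: eqP ls => // ->; rewrite (negPf ks).
(* The range [n.-1.+1] is the maximum of n and 1: it is nonempty even for n = 0, as [inord]
   requires. *)
have pk_ltn (l : st_class pk) : size (repr l) = n -> (pk (repr l) < n.-1.+1)%N.
  by move=> sl; have := pk_lt (repr l); rewrite sl; case: (n).
have cE m : \sum_(j < n.-1.+1) c j * pk_coef n j m = 0.
  transitivity ((phi f)`_n m); last by rewrite f0 coef0.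
  rewrite pk_map_coef (partition_big (fun l => inord (pk (repr l)) : 'I_n.-1.+1) xpredT) //.
  apply: eq_bigr => j _; rewrite /c mulr_suml; apply: eq_big => l.
    by case: eqP => // sl; rewrite -val_eqE [val _]/= inordK ?pk_ltn.
  by move=> /andP[_ /eqP ->].
(* Independence is stated for n > 0; in length 0 only j = 0 occurs, with series 1. *)
rewrite -ck; have [n0|n0] := posnP n.
  move: (cE 0%N) (pk_ltn k erefl); rewrite n0 big_ord1 /pk_coef mulr1.
  by case: (pk _).
exact: pk_coef_independent n0 cE _ (pk_ltn k erefl).
Qed.

(** One inclusion is [pk_bound], the other is the realisation of all admissible peak numbers by
    [pk_exists]. *)
Lemma range_pk_map : range phi = pk_series_span.
Proof.
apply/seteqP; split=> [_ [f _ <-]|].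
  elim/shuffle_alg_ind: f => [|a p f IH]; first by rewrite linear0; exact: lspan0.
  have -> : phi (a *: cls p + f) = a *: pk_image p + phi f.
    by rewrite -pk_map_class; exact: linearP.
  apply: lspan_linear IH; apply: lspan_sub.
  have [p0|p0] := posnP (size p); [left | right].
    by rewrite /pk_image p0.
  exists (size p), (pk p); split=> //; first by have := pk_bound p0; lia.
  by rewrite pk_imageE pk_seriesE.
apply: lspan_min.
- by exists 0; rewrite ?linear0.
- by move=> a _ _ [f _ <-] [g _ <-]; exists (a *: f + g); rewrite ?linearP.
move=> _ [->|[n [j [n1 jn ->]]]].
  by exists (cls wperm0) => //; rewrite pk_map_class.
have [|p [sp pp]] := @pk_exists n j; first by lia.
by exists (cls p); rewrite // pk_map_class pk_imageE sp pp pk_seriesE.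
Qed.

(** The bound j < (n + 1) %/ 2 amounts to 2j + 1 <= n. One permutation for each such j represents
    every class of length n exactly once. *)
Lemma homog_component_dim n : (1 <= n)%N ->
  has_dim (homog_component hpk n) ((n + 1) %/ 2)%N.
Proof.
move=> n1; set d := ((n + 1) %/ 2)%N.
have [p pP] : {p : 'I_d -> wperm & forall j, size (p j) = n /\ pk (p j) = j}.
  apply: (@boolp.choice _ _ (fun (j : 'I_d) p => size (word p) = n /\ pk p = j)) => j.
  apply: pk_exists; have := ltn_ord j; rewrite /d; lia.
exists (fun j => cls (p j)); split=> [c c0 j|].
  have /= := congr1 (fun f : A => coefA f (\pi_(st_class pk) (p j))%qT) c0.
  rewrite monalg.mcoeff0 raddf_sum /= (bigD1 j) //= big1 => [|i ij].
    by rewrite monalg.mcoeffZ monalg.mcoeffUU mulr1 addr0.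
  rewrite monalg.mcoeffZ monalg.mcoeffU; case: st_classP => [[_ ij']|]; last by rewrite mulr0.
  have [[_ pi] [_ pj]] := (pP i, pP j).
  by rewrite -val_eqE /= -pi -pj ij' eqxx in ij.
apply/seteqP; split; apply: lspanS => f.
  move=> [q sq ->]; apply: lspan_sub.
  have qd : (pk q < d)%N by have := @pk_bound q; rewrite sq /d; lia.
  exists (Ordinal qd) => //; apply/eqP/class_ofP.
  by have [-> ->] := pP (Ordinal qd).
move=> [j _ <-]; apply: lspan_sub; exists (p j) => //.
by have [] := pP j.
Qed.

End PeakIsomorphism.

(** * The polynomial model *)

(** The map [psi] is the inverse of [ev] on [U] composed with [phi]; injectivity of [ev] makes it
    linear and multiplicative. *)
Lemma iso_onto_transfer (A B C : algType rat) (phi : {lrmorphism A -> B})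
    (ev : C -> B) (U : set B) (W : set C) :
  linear ev -> monoid_morphism ev -> injective ev -> (ev @` W)%classic = U ->
  iso_onto phi U ->
  subalgebra W /\ exists psi : {lrmorphism A -> C}, iso_onto psi W.
Proof.
move=> evL [ev1 evM] evI evW [phiI phiU].
have [psi psiP] : {psi : A -> C & forall a, W (psi a) /\ ev (psi a) = phi a}.
  apply: (@boolp.choice _ _ (fun a c => W c /\ ev c = phi a)) => a.
  have : U (phi a) by rewrite -phiU; exists a.
  by rewrite -evW => -[c Wc <-]; exists c.
have psiE a : ev (psi a) = phi a by have [] := psiP a.
have psiL : linear psi.
  by move=> a u v; apply: evI; rewrite evL !psiE linearP.
have psiM : monoid_morphism psi.
  by split=> [|u v]; apply: evI; rewrite ?ev1 ?evM !psiE ?rmorph1 ?rmorphM.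
pose psi_linear := GRing.isLinear.Build rat A C _ psi psiL.
pose psi_morphism := GRing.isMonoidMorphism.Build A C psi psiM.
pose psi' : {lrmorphism A -> C} := HB.pack psi psi_linear psi_morphism.
have psi'W : range psi' = W.
  apply/seteqP; split=> [_ [a _ <-]|c Wc]; first by have [] := psiP a.
  have : U (ev c) by rewrite -evW; exists c.
  rewrite -phiU => -[a _ E]; exists a => //.
  by apply: evI; rewrite -E; exact: psiE.
split; first exact: range_subalgebra psi'W.
exists psi'; split=> // a b /(congr1 ev) E.
by apply: phiI; rewrite -!psiE; exact: E.
Qed.

Lemma poly_nat_eq0 (q : {poly rat}) : (forall k : nat, q.[k%:R] = 0) -> q = 0.
Proof.
move=> q0; apply: (@roots_geq_poly_eq0 _ _ [seq k%:R | k <- iota 0 (size q)]).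
- by apply/allP => _ /mapP[k _ ->]; rewrite /root q0.
- by rewrite map_inj_uniq ?iota_uniq // => k l /eqP; rewrite eqr_nat => /eqP.
- by rewrite size_map size_iota.
Qed.

Definition powers (i : nat) : hadamard := fun m => m%:R ^+ i.

(** The variable p becomes the sequence m, so Hadamard products are products of polynomial functions
    of m. *)
Definition eval_vars (i : 'I_2) : hpoly := if i == ord0 then (powers 1)%:P else 'X.

Definition poly_eval : Qpx -> hpoly := mpoly.mmap (in_alg hpoly) eval_vars.

Lemma poly_eval_linear : linear poly_eval.
Proof. by move=> a u v; rewrite /poly_eval mpoly.mmapD mpoly.mmapZ mulr_algl. Qed.

Lemma poly_eval_monoid_morphism : monoid_morphism poly_eval.
Proof. by have [] := mpoly.mmap_is_multiplicative eval_vars (in_alg hpoly). Qed.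

Lemma powersX i : powers 1 ^+ i = powers i.
Proof.
elim: i => // i IH; rewrite exprS IH; apply/funext => m.
by rewrite hadamardM /powers -exprD add1n.
Qed.

Lemma mmap1_eval_vars (m : mpoly.multinom 2) :
  mpoly.mmap1 eval_vars m = (powers (m ord0))%:P * 'X^(m ord_max).
Proof.
rewrite /mpoly.mmap1 big_ord_recr big_ord1 /eval_vars /=.
rewrite -polyC_exp powersX; congr ((powers (m _))%:P * _).
exact: val_inj.
Qed.

Lemma poly_evalX (m : mpoly.multinom 2) :
  poly_eval 'X_[m] = (powers (m ord0))%:P * 'X^(m ord_max).
Proof. by rewrite -mmap1_eval_vars; exact: mpoly.mmapX. Qed.

Lemma coef_poly_eval (P : Qpx) n k :
  (poly_eval P)`_n k = \sum_(m <- mpoly.msupp P | m ord_max == n)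
     mpoly.mcoeff m P * k%:R ^+ (m ord0).
Proof.
rewrite /poly_eval /mpoly.mmap.
transitivity (\sum_(m <- mpoly.msupp P)
    mpoly.mcoeff m P * (mpoly.mmap1 eval_vars m)`_n k).
  elim/big_ind2: _ => [|u a v b <- <-|m _]; first by rewrite coef0.
    by rewrite coefD.
  by rewrite mulr_algl; exact: coef_hpolyZ.
rewrite [RHS]big_mkcond; apply: eq_bigr => m _.
rewrite mmap1_eval_vars coefMXn coefC.
have [->|ne] := eqVneq (m ord_max) n; first by rewrite ltnn subnn.
case: ltnP => [_|le]; first by rewrite mulr0.
by rewrite subn_eq0 leqNgt ltn_neqAle ne le mulr0.
Qed.

(** For a fixed power of x, the coefficients form a polynomial in p that vanishes at every natural
    number. *)
Lemma poly_eval_inj : injective poly_eval.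
Proof.
suff inj0 P : poly_eval P = 0 -> P = 0.
  move=> P Q PQ; apply/eqP; rewrite -subr_eq0; apply/eqP/inj0.
  by rewrite addrC -scaleN1r poly_eval_linear PQ scaleN1r addNr.
move=> P0; apply/mpoly.mpolyP => m; rewrite mpoly.mcoeff0.
pose q : {poly rat} := \sum_(l <- mpoly.msupp P | l ord_max == m ord_max)
  mpoly.mcoeff l P *: 'X^(l ord0).
have /(congr1 (fun r : {poly rat} => r`_(m ord0))) : q = 0.
  apply: poly_nat_eq0 => k; rewrite horner_sum.
  transitivity ((poly_eval P)`_(m ord_max) k); last by rewrite P0 coef0.
  by rewrite coef_poly_eval; apply: eq_bigr => l _; rewrite !hornerE.
rewrite coef0 coef_sum; under eq_bigr do rewrite coefZ coefXn.
have only_m (l : mpoly.multinom 2) :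
    (l ord_max == m ord_max) && (m ord0 == l ord0) = (l == m).
  apply/andP/eqP => [[/eqP l1 /eqP l0]|->]; last by rewrite !eqxx.
  apply/mnmP => -[[|[|//]] i2].
    by rewrite (_ : Ordinal i2 = ord0) //; exact: val_inj.
  by rewrite (_ : Ordinal i2 = ord_max) //; exact: val_inj.
have [ms|ms] := boolP (m \in mpoly.msupp P); last first.
  by move=> _; apply: mpoly.memN_msupp_eq0.
rewrite big_mkcond (bigD1_seq m) ?mpoly.msupp_uniq //= !eqxx mulr1 big1 ?addr0 // => l lm.
case: eqP (only_m l) => //= _; rewrite (negPf lm) => ->; exact: mulr0.
Qed.

Lemma poly_eval_powers i n :
  poly_eval (var_p ^+ i * var_x ^+ n) = (powers i)%:P * 'X^n.
Proof.
have [_ evM] := poly_eval_monoid_morphism.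
rewrite evM /var_p /var_x !mpoly.mpolyXn !poly_evalX !mpoly.mulmnE !mpoly.mnm1E /=.
by rewrite !mul1n !mul0n mul1r mulr1.
Qed.

Lemma pk_coef_rec n j : (2 * j + 1 <= n)%N ->
  pk_coef n j = pk_coef n.+2 j - pk_coef n.+2 j.+1.
Proof.
move=> jn; have n0 : (0 < n)%N by lia.
apply: (@cmul_1subX_inj n.+3).
rewrite -[n.+3]/(2 + n.+1)%N exprD cmulM cmul_pk_coef // cmul_coef -exprD.
apply/funext => m; rewrite [RHS]cmulBr !cmul_pk_coef // -coefB.
congr (nth _ (polyseq _) _).
(* The two numerators for n + 2 are (1 + X)^2 and 4X times the one for n. *)
rewrite [pk_num n.+2 j.+1]pk_numS_half; last by lia.
rewrite pk_half_numS_num // !pk_numS //; last by lia.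
by rewrite -mul_polyC; ring.
Qed.

Lemma opc_shift k (p : wperm) m : opc m (shift_perm k p) = opc m p.
Proof.
have so := shift_same_order k p.
by rewrite !opc_pk (statP pk so) -so.1.
Qed.

(* The sum of [opc m] over the n-fold shuffle product of a one-letter permutation. *)
Lemma powers_sum_opc n : exists2 L : seq wperm, all (fun u : wperm => size u == n) L &
  forall m, (2%:R * m%:R) ^+ n = \sum_(u <- L) opc m u.
Proof.
elim: n => [|n [L Ln LE]].
  by exists [:: wperm0] => // m; rewrite big_seq1 opc_nil.
pose p := @WPerm [:: 1%N] isT.
exists (flatten [seq shuffles p (away p u) | u <- L]).
  apply/allP => v /flatten_mapP[u uL /(shuffles_size (away_disjoint p u)) ->].
  by rewrite /= size_map (eqP (allP Ln _ uL)).
move=> m; rewrite exprS LE mulr_sumr big_flatten big_map.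
apply: eq_bigr => u _; rewrite -opcM ?away_disjoint // opc_shift; congr (_ * _).
(* On a single letter [opc m] is 2m. *)
elim: m => [|m IH]; first by rewrite mulr0.
by rewrite opcS1 -IH -[m.+1]addn1 natrD mulrDr mulr1.
Qed.

(** Places series in [hpoly], whose structure of Q-module [lspan] uses. *)
Definition hpolyC (s : hadamard) : hpoly := s%:P.

(** * Peak series and powers of equal parity *)

Section EvenOddSpans.

Definition coef_span (n : nat) : set hpoly :=
  lspan [set v : hpoly | exists2 j, (2 * j + 1 <= n)%N & v = hpolyC (pk_coef n j)].

Definition powers_span (n : nat) : set hpoly :=
  lspan [set v : hpoly | exists i, [/\ (1 <= i <= n)%N, i = n %[mod 2] & v = hpolyC (powers i)]].

Lemma hpolyCB (s s' : hadamard) : hpolyC (s - s') = hpolyC s - hpolyC s'.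
Proof. exact: polyCB. Qed.

Lemma hpolyC_sum (I : Type) (r : seq I) (F : I -> hadamard) :
  hpolyC (\sum_(i <- r) F i) = \sum_(i <- r) hpolyC (F i).
Proof. exact: (rmorph_sum (polyC : {rmorphism hadamard -> {poly hadamard}})). Qed.

Lemma hpolyCZ (a : rat) (s : hadamard) : a *: hpolyC s = hpolyC (hconst a * s).
Proof. by rewrite /hpolyC polyCM. Qed.

Lemma lspan_mull (S : set hpoly) (U : set hpoly) w :
  (forall v, S v -> lspan U (v * w)) -> forall v, lspan S v -> lspan U (v * w).
Proof.
move=> SU; apply: (@lspan_min _ _ (fun v => lspan U (v * w))).
- by rewrite mul0r; exact: lspan0.
- by move=> a u v Uu Uv; rewrite mulrDl -scalerAl; exact: lspan_linear.
- exact: SU.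
Qed.

Lemma powers_spanS n : (powers_span n `<=` powers_span n.+2)%classic.
Proof.
apply: lspanS => _ [i [/andP[i1 i_n] i2 ->]]; apply: lspan_sub; exists i.
by split=> //; lia.
Qed.

Lemma coef_spanS n : (coef_span n `<=` coef_span n.+2)%classic.
Proof.
apply: lspanS => _ [j jn ->]; rewrite (pk_coef_rec jn) hpolyCB.
by apply: lspanB; apply: lspan_sub; [exists j | exists j.+1] => //; lia.
Qed.

Lemma powers_sum_pk n : exists2 L : seq wperm,
  (size L != 0)%N /\ all (fun u : wperm => size u == n) L &
  (2%:R ^+ n) *: hpolyC (powers n) = \sum_(u <- L) hpolyC (pk_coef n (pk u)).
Proof.
have [L Ln LE] := powers_sum_opc n; exists L.
  (* At m = 1 the sum is 2^n, hence nonzero, so [L] is not empty. *)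
  split=> //; apply: contra_eqN (LE 1%N) => /nilP ->.
  by rewrite big_nil mulr1 expf_eq0 pnatr_eq0 andbF.
rewrite hpolyCZ -hpolyC_sum; congr hpolyC; apply/funext => m.
rewrite hadamardM /hconst /powers -exprMn LE.
transitivity (\sum_(u <- L) pk_coef n (pk u) m).
  by apply: eq_big_seq => u /(allP Ln) /eqP <-; rewrite opc_pk.
by elim/big_ind2: _ => // x1 x2 y1 y2 -> ->.
Qed.

(** For n = i, (2m)^i is a sum of peak series of length i; [coef_spanS] then raises n by 2 at a
    time. *)
Lemma powers_in_coef_span n i : (1 <= i <= n)%N -> i = n %[mod 2] ->
  coef_span n (hpolyC (powers i)).
Proof.
move=> /andP[i1 i_n] i2; have [k ->] : exists k, n = (i + k.*2)%N.
  by exists ((n - i) %/ 2)%N; lia.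
elim: k {i_n i2} => [|k IH]; last by rewrite doubleS !addnS; exact: coef_spanS.
have [L [_ Li] LE] := powers_sum_pk i; rewrite addn0.
have -> : hpolyC (powers i) = (2%:R ^- i) *: (2%:R ^+ i *: hpolyC (powers i)) :> hpoly.
  by rewrite scalerA mulVf ?scale1r // expf_eq0 pnatr_eq0 andbF.
rewrite LE; apply: lspanZ; apply: lspan_sum => u /(allP Li) /eqP ui.
apply: lspan_sub; exists (pk u) => //.
by rewrite -ui; apply: pk_bound; rewrite ui.
Qed.

(** By [pk_coef_rec] the differences f_(n,i) - f_(n,0) telescope into terms f_(n-2,k), covered by
    induction. Since (2m)^n is a sum of |L| terms f_(n,j), it differs from |L| f_(n,0) by such
    differences, and f_(n,0) can be solved for. *)
Lemma coef_in_powers_span n j : (2 * j + 1 <= n)%N -> powers_span n (hpolyC (pk_coef n j)).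
Proof.
elim/ltn_ind: n j => n IH j jn.
have diff i : (2 * i + 1 <= n)%N ->
    powers_span n (hpolyC (pk_coef n i) - hpolyC (pk_coef n 0)).
  elim: i => [|i IHi] i_n; first by rewrite subrr; exact: lspan0.
  have [n' nE] : exists n', n = n'.+2 by exists (n - 2)%N; lia.
  have i_n' : (2 * i + 1 <= n')%N by lia.
  have -> : hpolyC (pk_coef n i.+1) - hpolyC (pk_coef n 0) =
      hpolyC (pk_coef n i) - hpolyC (pk_coef n 0) - hpolyC (pk_coef n' i) :> hpoly.
    by rewrite (pk_coef_rec i_n') -nE hpolyCB opprB [RHS]addrC addrA subrK.
  apply: lspanB; first by apply: IHi; lia.
  by rewrite nE; apply: powers_spanS; apply: IH => //; rewrite nE.
have n0 : (0 < n)%N by lia.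
have [L [L0 Ln] LE] := powers_sum_pk n.
suff c0 : powers_span n (hpolyC (pk_coef n 0)).
  by rewrite -[hpolyC _](subrK (hpolyC (pk_coef n 0))); apply: lspanD => //; exact: diff.
have L0' : (size L)%:R != 0 :> rat by rewrite pnatr_eq0.
have -> : hpolyC (pk_coef n 0) = (size L)%:R^-1 *: (2%:R ^+ n *: hpolyC (powers n) -
    \sum_(u <- L) (hpolyC (pk_coef n (pk u)) - hpolyC (pk_coef n 0))) :> hpoly.
  rewrite LE sumrB opprB addrCA subrr addr0 big_const_seq count_predT iter_addr_0.
  by rewrite -scaler_nat scalerA mulVf ?scale1r.
apply/lspanZ/lspanB.
  by apply/lspanZ/lspan_sub; exists n; rewrite n0 leqnn.
apply: lspan_sum => u /(allP Ln) /eqP un; apply: diff.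
by rewrite -un; apply: pk_bound; rewrite un.
Qed.

End EvenOddSpans.

(** Multiplying the comparison of [coef_span n] and [powers_span n] by x^n gives both inclusions; 1
    corresponds to 1 / (1 - t). *)
Lemma poly_eval_span : (poly_eval @` pk_poly_span)%classic = pk_series_span.
Proof.
have [ev1 evM] := poly_eval_monoid_morphism.
have ev0 : poly_eval 0 = 0.
  by have := poly_eval_linear (-1) 0 0; rewrite scaler0 addr0 scaleN1r addNr.
have ev_closed a u v : (poly_eval @` pk_poly_span)%classic u ->
    (poly_eval @` pk_poly_span)%classic v ->
    (poly_eval @` pk_poly_span)%classic (a *: u + v).
  move=> [P PU <-] [Q QU <-]; exists (a *: P + Q); first exact: lspan_linear.
  exact: poly_eval_linear.
have im0 : (poly_eval @` pk_poly_span)%classic 0 by exists 0 => //; exact: lspan0.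
apply/seteqP; split.
  suff sub : (pk_poly_span `<=` (fun P => pk_series_span (poly_eval P)))%classic.
    by move=> _ [P PU <-]; exact: sub.
  apply: lspan_min => [|a P Q|_ [->|[n [i [n1 /andP[i1 i_n] i2 ->]]]]].
  - by rewrite ev0; exact: lspan0.
  - by rewrite poly_eval_linear; exact: lspan_linear.
  - by rewrite ev1 -geom_series1; apply: lspan_sub; left.
  rewrite poly_eval_powers -/(hpolyC _).
  have := @powers_in_coef_span n i; rewrite i1 i_n => /(_ isT i2).
  move: (hpolyC _); apply: lspan_mull => _ [j jn ->].
  by rewrite -pk_seriesE //; apply: lspan_sub; right; exists n, j; split=> //; lia.
apply: lspan_min => // _ [->|[n [j [n1 jn ->]]]].
  by exists 1; [apply: lspan_sub; left | rewrite ev1 geom_series1].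
rewrite pk_seriesE //.
suff sub : (powers_span n `<=`
    (fun v => (poly_eval @` pk_poly_span)%classic (v * 'X^n)))%classic.
  by apply: (sub (hpolyC (pk_coef n j))); apply: coef_in_powers_span; lia.
apply: lspan_min.
- by rewrite mul0r.
- by move=> a u v Uu Uv; rewrite mulrDl -scalerAl; exact: ev_closed.
move=> _ [i [/andP[i1 i_n] i2 ->]].
exists (var_p ^+ i * var_x ^+ n); last exact: poly_eval_powers.
by apply: lspan_sub; right; exists n, i; rewrite i1 i_n.
Qed.

Theorem theorem4p8 :
  exists hpk : shuffle_compatible pk,
    [/\ (exists phi : {lrmorphism shuffle_alg hpk -> hpoly},
           [/\ forall p : wperm, phi (class_of hpk p) = pk_image p,
               subalgebra pk_series_span
             & iso_onto phi pk_series_span]),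
        (subalgebra pk_poly_span /\
         exists psi : {lrmorphism shuffle_alg hpk -> Qpx},
           iso_onto psi pk_poly_span)
      & forall n : nat, (1 <= n)%N ->
          has_dim (homog_component hpk n) ((n + 1) %/ 2)%N].
Proof.
exists pk_compatible; split.
- exists (pk_map pk_compatible); split.
  + exact: pk_map_class.
  + exact: range_subalgebra (range_pk_map pk_compatible).
  + by split; [exact: pk_map_inj | exact: range_pk_map].
- apply: iso_onto_transfer poly_eval_linear poly_eval_monoid_morphism poly_eval_inj
    poly_eval_span _.
  by split; [exact: pk_map_inj | exact: range_pk_map].
- exact: homog_component_dim.
Qed.
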